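(* Let $S$ be a semiring with a Strassen preorder, and $i:S\to\overline S$ an asymptotic completion. (i) If $f:S\to\mathbb R_{\ge0}$ is a regular lower functional, then there exists a unique regular lower functional $\overline f:\overline S\to\mathbb R_{\ge0}$ such that $\overline f\circ i=f$. (ii) If $g:S\to\mathbb R_{\ge0}$ is a regular upper functional, then there exists a unique regular upper functional $\overline g:\overline S\to\mathbb R_{\ge0}$ such that $\overline g\circ i=g$.
   Context: Semirings are commutative, with $0$ and $1$. A preordered semiring is a semiring $S$ with a reflexive transitive relation $\le$ such that $x\le y$ implies $z+x\le z+y$ and $zx\le zy$ for all $x,y,z\in S$; it is a partially ordered semiring if $\le$ is also antisymmetric. Monotone homomorphisms are order-preserving semiring homomorphisms. A nonzero element $u\in S$ is power universal if $1\le u$ and for all nonzero $x,y\in S$ with $x\le y$ there is $k\in\mathbb N$ with $y\le u^kx$; $S$ is of polynomial growth if it has a power universal element. All preordered semirings are assumed to be of polynomial growth, with a fixed power universal element $u$ (the notions below do not depend on the choice). $\mathbb N$ includes $0$. A sublinear sequence is a sequence $(k_n)_{n\in\mathbb N}$ in $\mathbb N$ with $\lim_{n\to\infty}k_n/n=0$. A preorder on a semiring $S$ making it a preordered semiring is a Strassen preorder if the unique semiring homomorphism $\mathbb N\to S$ is an order embedding and $u=2$ is power universal. A lower functional on a preordered semiring $S$ is a map $f:S\to\mathbb R_{\ge0}$ with $f(0)=0$, $f(1)=1$, $f(x+y)\ge f(x)+f(y)$, $f(xy)\ge f(x)f(y)$ for all $x,y$, and $x\le y\Rightarrow f(x)\le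 f(y)$. An upper functional is a map $g:S\to\mathbb R_{\ge0}$ with $g(0)=0$, $g(1)=1$, $g(x+y)\le g(x)+g(y)$, $g(xy)\le g(x)g(y)$, and $x\le y\Rightarrow g(x)\le g(y)$. A lower or upper functional $f$ is regular if $f(p(x))=p(f(x))$ for all $x\in S$ and all univariate polynomials $p$ with coefficients in $\mathbb N$. For $a,b\in S^{\mathbb N}$: $(a\oplus b)_n=\sum_{m=0}^n\binom nm a_{n-m}b_m$; $(a\odot b)_n=a_nb_n$; $a\lesssim b$ means that there is a sublinear sequence $(k_n)$ with $a_n\le u^{k_n}b_n$ for all $n\in\mathbb N$; $a\approx b$ means $a\lesssim b$ and $b\lesssim a$. For $s\in S$, $G(s)=(1,s,s^2,\dots)$. A sequence $a\in S^{\mathbb N}$ is approximately geometric if either $a\approx G(0)$, or $a_n\ne0$ for all $n$ and there is a sublinear sequence $(k_n)$ such that for all $t\in\mathbb N_{>0}$ and $n_1,\dots,n_t\in\mathbb N$ both $a_{n_1}\cdots a_{n_t}\le u^{k_{n_1}+\dots+k_{n_t}}a_{n_1+\dots+n_t}$ and $a_{n_1+\dots+n_t}\le u^{k_{n_1}+\dots+k_{n_t}}a_{n_1}\cdots a_{n_t}$ hold. $S$ is closed if $G(x)\lesssim G(y)$ implies $x\le y$ for all $x,y\in S$, and asymptotically complete if for every approximately geometric sequence $a\in(S\setminus\{0\})^{\mathbb N}$ there is $s\in S$ with $a\approx G(s)$. An asymptotic completion of $S$ is a closed, asymptotically complete partially ordered semiring $\overline S$ with a monotone homomorphism $i:S\to\overline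 S$ such that $i(u)$ is power universal and every monotone homomorphism $f$ from $S$ to an asymptotically complete closed partially ordered semiring $T$ factors uniquely as $f=g\circ i$ with $g:\overline S\to T$ a monotone homomorphism. It is unique up to isomorphism, and is realized by the set of $\approx$-classes $[a]$ of approximately geometric sequences in $S$, with addition, multiplication and order induced by $\oplus,\odot,\lesssim$, and $i(s)=[G(s)]$. *)

(* Defs.v *)
From HB Require Import structures.
From mathcomp Require Import all_boot all_order all_algebra.
From mathcomp Require Import all_classical all_reals all_analysis.
Import Order.TTheory GRing.Theory Num.Theory.
Import numFieldNormedType.Exports.

Set Implicit Arguments.
Unset Strict Implicit.
Unset Printing Implicit Defensive.

Local Open Scope classical_set_scope.
Local Open Scope ring_scope.

Record preordered_semiring (S : comPzSemiRingType) (le : S -> S -> Prop) : Prop :=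
  PreorderedSemiring {
    psr_refl : forall x, le x x;
    psr_trans : forall x y z, le x y -> le y z -> le x z;
    psr_add : forall x y z, le x y -> le (z + x) (z + y);
    psr_mul : forall x y z, le x y -> le (z * x) (z * y) }.

Definition partially_ordered_semiring (S : comPzSemiRingType)
    (le : S -> S -> Prop) : Prop :=
  preordered_semiring le /\ forall x y, le x y -> le y x -> x = y.

Definition power_universal (S : comPzSemiRingType) (le : S -> S -> Prop)
    (u : S) : Prop :=
  [/\ u <> 0, le 1 u &
      forall x y, x <> 0 -> y <> 0 -> le x y ->
        exists k : nat, le y (u ^+ k * x)].

Definition strassen_preorder (S : comPzSemiRingType)
    (le : S -> S -> Prop) : Prop :=
  [/\ preordered_semiring le,
      forall m n : nat, le m%:R n%:R <-> (m <= n)%N &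
      power_universal le 2%:R].

(* The quotients and their limit are rational, so the limit is taken in rat;
   this keeps the order-theoretic notions below independent of a model of the
   reals. The junk value at n = 0 is irrelevant to the limit. *)
Definition sublinear (k : nat -> nat) : Prop :=
  (fun n : nat => (k n)%:R / n%:R : rat^o) @ \oo --> (0 : rat^o).

(* In all notions below that take an argument u, it is the fixed power
   universal element of the preordered semiring (S, le). *)
Definition asymp_le (S : comPzSemiRingType) (le : S -> S -> Prop) (u : S)
    (a b : nat -> S) : Prop :=
  exists2 k : nat -> nat, sublinear k & forall n, le (a n) (u ^+ k n * b n).

Definition asymp_eq (S : comPzSemiRingType) (le : S -> S -> Prop) (u : S)
    (a b : nat -> S) : Prop :=
  asymp_le le u a b /\ asymp_le le u b a.

(* geom 0 is (1, 0, 0, ...), since 0 ^+ 0 = 1. *)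
Definition geom (S : comPzSemiRingType) (s : S) : nat -> S := fun n => s ^+ n.

Definition approx_geometric (S : comPzSemiRingType) (le : S -> S -> Prop)
    (u : S) (a : nat -> S) : Prop :=
  asymp_eq le u a (geom 0) \/
  (forall n, a n <> 0) /\
  exists2 k : nat -> nat, sublinear k &
    forall (t : nat) (n : 'I_t -> nat), (0 < t)%N ->
      le (\prod_(j < t) a (n j))
         (u ^+ (\sum_(j < t) k (n j))%N * a (\sum_(j < t) n j)%N) /\
      le (a (\sum_(j < t) n j)%N)
         (u ^+ (\sum_(j < t) k (n j))%N * \prod_(j < t) a (n j)).

Definition asymp_closed (S : comPzSemiRingType) (le : S -> S -> Prop)
    (u : S) : Prop :=
  forall x y : S, asymp_le le u (geom x) (geom y) -> le x y.

Definition asymp_complete (S : comPzSemiRingType) (le : S -> S -> Prop)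
    (u : S) : Prop :=
  forall a : nat -> S, (forall n, a n <> 0) -> approx_geometric le u a ->
    exists s : S, asymp_eq le u a (geom s).

Definition monotone_map (S T : Type) (leS : S -> S -> Prop) (leT : T -> T -> Prop)
    (f : S -> T) : Prop :=
  forall x y, leS x y -> leT (f x) (f y).

Record asymptotic_completion (S : comPzSemiRingType) (le : S -> S -> Prop)
    (u : S) (Sbar : comPzSemiRingType) (lebar : Sbar -> Sbar -> Prop)
    (i : {rmorphism S -> Sbar}) : Prop := AsymptoticCompletion {
  completion_po : partially_ordered_semiring lebar;
  completion_mono : monotone_map le lebar i;
  completion_pu : power_universal lebar (i u);
  completion_closed : asymp_closed lebar (i u);
  completion_complete : asymp_complete lebar (i u);
  completion_univ :
    forall (T : comPzSemiRingType) (leT : T -> T -> Prop) (v : T),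
      partially_ordered_semiring leT -> power_universal leT v ->
      asymp_closed leT v -> asymp_complete leT v ->
      forall f : {rmorphism S -> T}, monotone_map le leT f ->
      exists g : {rmorphism Sbar -> T},
        [/\ monotone_map lebar leT g, f =1 g \o i &
            forall g' : {rmorphism Sbar -> T},
              monotone_map lebar leT g' -> f =1 g' \o i -> g' =1 g] }.

Record lower_functional (R : realType) (S : comPzSemiRingType)
    (le : S -> S -> Prop) (f : S -> R) : Prop := LowerFunctional {
  lower_ge0 : forall x, 0 <= f x;
  lower0 : f 0 = 0;
  lower1 : f 1 = 1;
  lowerD : forall x y, f x + f y <= f (x + y);
  lowerM : forall x y, f x * f y <= f (x * y);
  lower_homo : forall x y, le x y -> f x <= f y }.

Record upper_functional (R : realType) (S : comPzSemiRingType)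
    (le : S -> S -> Prop) (g : S -> R) : Prop := UpperFunctional {
  upper_ge0 : forall x, 0 <= g x;
  upper0 : g 0 = 0;
  upper1 : g 1 = 1;
  upperD : forall x y, g (x + y) <= g x + g y;
  upperM : forall x y, g (x * y) <= g x * g y;
  upper_homo : forall x y, le x y -> g x <= g y }.

(* Written out because {poly A}, hence horner, requires 1 <> 0 in A. *)
Definition nat_poly_eval (A : pzSemiRingType) (p : {poly nat}) (x : A) : A :=
  \sum_(j < size p) x ^+ j *+ (p`_j)%R.

Definition regular (R : realType) (S : comPzSemiRingType) (f : S -> R) : Prop :=
  forall (x : S) (p : {poly nat}),
    f (nat_poly_eval p x) = nat_poly_eval p (f x).

Definition regular_lower_functional (R : realType) (S : comPzSemiRingType)
    (le : S -> S -> Prop) (f : S -> R) : Prop :=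
  lower_functional le f /\ regular f.

Definition regular_upper_functional (R : realType) (S : comPzSemiRingType)
    (le : S -> S -> Prop) (g : S -> R) : Prop :=
  upper_functional le g /\ regular g.

(* Main.v *)
(* Two elements of [S] are compared asymptotically by [geo_le]. Strassen duality
   (a maximal consistent preorder is total and so defines a homomorphism to
   the nonnegative reals) shows that [geo_le] is detected by the monotone
   homomorphisms from [S] to the nonnegative reals; as these form a closed,
   asymptotically complete semiring, the homomorphisms factor through [i], so
   [lebar (i x) (i y)] implies [geo_le le x y] and hence [f x <= f y] for every
   regular monotone [f].
   The elements [x] of [Sbar] some power of which lies, up to small powers of 2,
   in the image of [i] form a closed, asymptotically complete subsemiring, which
   is everything by the uniqueness in the universal property. So the value of
   an extension at [x] is forced: it is the only [z] such that [z ^+ e] is close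
   to [f b] whenever [x ^+ e] is close to [i b]. The functional inequalities
   pass to the extension because [(x + y) ^+ N] and [p(x) ^+ N] are close to
   the sums in which every [x ^+ j] is replaced by [b ^+ (j %/ e)]. *)
Require Import Defs.
From HB Require Import structures.
From mathcomp Require Import all_boot all_order all_algebra.
From mathcomp Require Import all_classical all_reals all_analysis.
From mathcomp Require Import lra zify.
Import Order.TTheory GRing.Theory Num.Theory.

Set Implicit Arguments.
Unset Strict Implicit.
Unset Printing Implicit Defensive.

Local Open Scope ring_scope.

(** * The asymptotic comparison of elements *)

Section PreorderedSemiring.
Variables (S : comPzSemiRingType) (le : S -> S -> Prop).
Hypothesis psr : preordered_semiring le.

Lemma psr_add2 a b c d : le a b -> le c d -> le (a + c) (b + d).
Proof.
move=> ab cd; apply: (psr_trans psr (psr_add psr a cd)).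
by rewrite (addrC a) (addrC b); exact: psr_add.
Qed.

Lemma psr_mul2 a b c d : le a b -> le c d -> le (a * c) (b * d).
Proof.
move=> ab cd; apply: (psr_trans psr (psr_mul psr a cd)).
by rewrite (mulrC a) (mulrC b); exact: psr_mul.
Qed.

Lemma psr_exp n a b : le a b -> le (a ^+ n) (b ^+ n).
Proof.
move=> ab; elim: n => [|n IHn]; first by rewrite !expr0; exact: psr_refl.
by rewrite !exprS; exact: psr_mul2.
Qed.

Lemma psr_muln n a b : le a b -> le (a *+ n) (b *+ n).
Proof.
move=> ab; elim: n => [|n IHn]; first by rewrite !mulr0n; exact: psr_refl.
by rewrite !mulrS; exact: psr_add2.
Qed.

Lemma psr_sum (I : Type) (r : seq I) (P : pred I) (F G : I -> S) :
  (forall i, P i -> le (F i) (G i)) ->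
  le (\sum_(i <- r | P i) F i) (\sum_(i <- r | P i) G i).
Proof.
by move=> FG; apply: big_ind2 => //; [exact: psr_refl|exact: psr_add2].
Qed.

Hypothesis le01 : le 0 1.

Lemma psr_ge0 x : le 0 x.
Proof. by have := psr_mul psr x le01; rewrite mulr0 mulr1. Qed.

Lemma psr_addr x y : le x (x + y).
Proof. by have := psr_add psr x (psr_ge0 y); rewrite addr0. Qed.

Lemma psr_leqn m n x : (m <= n)%N -> le (x *+ m) (x *+ n).
Proof. by move=> /subnKC <-; rewrite mulrnDr; exact: psr_addr. Qed.

Lemma psr_pow2 m n x : (m <= n)%N -> le (2%:R ^+ m * x) (2%:R ^+ n * x).
Proof.
move=> mn; rewrite -!natrX !mulr_natl; apply: psr_leqn.
by rewrite leq_pexp2l.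
Qed.

Lemma psr_pow2_trans m n x y z :
  le x (2%:R ^+ m * y) -> le y (2%:R ^+ n * z) -> le x (2%:R ^+ (m + n) * z).
Proof.
move=> xy yz; apply: (psr_trans psr xy).
by rewrite exprD -mulrA; exact: psr_mul.
Qed.

Lemma psr_pow2_exp n m x y :
  le x (2%:R ^+ m * y) -> le (x ^+ n) (2%:R ^+ (m * n) * y ^+ n).
Proof. by move=> /(psr_exp n); rewrite exprMn exprM. Qed.

Lemma psr_pow2_mul m n x y z t :
  le x (2%:R ^+ m * y) -> le z (2%:R ^+ n * t) ->
  le (x * z) (2%:R ^+ (m + n) * (y * t)).
Proof. by move=> xy zt; rewrite exprD mulrACA; exact: psr_mul2. Qed.

Lemma psr_pow2_leq m n x y :
  (m <= n)%N -> le x (2%:R ^+ m * y) -> le x (2%:R ^+ n * y).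
Proof. by move=> /(psr_pow2 y) mn xy; exact: psr_trans xy mn. Qed.

End PreorderedSemiring.

Record strassen_like (S : comPzSemiRingType) (le : S -> S -> Prop) : Prop :=
  StrassenLike {
    sl_psr :> preordered_semiring le;
    sl_ge0 : le 0 1;
    sl_10 : ~ le 1 0;
    sl_bound : forall x, x <> 0 ->
      exists k, le 1 (2%:R ^+ k * x) /\ le x (2%:R ^+ k) }.

(* Comparing [x] and [y] with [1 + x] turns power universality, which only
   concerns comparable pairs, into two-sided bounds on every nonzero [x]. *)
Lemma power_universal_strassen_like (S : comPzSemiRingType)
    (le : S -> S -> Prop) :
  preordered_semiring le -> le 0 1 -> ~ le 1 0 -> power_universal le 2%:R ->
  strassen_like le.
Proof.
move=> H h01 h10 [_ _ pu]; split=> // x x0.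
have le1 : le 1 (1 + x) by exact: psr_addr.
have lex : le x (1 + x) by rewrite addrC; exact: psr_addr.
have n0 : 1 + x <> 0 by move=> e; apply: h10; move: le1; rewrite e.
have [e1|ne1] := eqVneq (1 : S) 0.
  by case: h10; rewrite e1; exact: psr_refl.
have [k hk] := pu _ _ (elimN eqP ne1) n0 le1.
have [l hl] := pu _ _ x0 n0 lex.
exists (k + l)%N; split.
  apply: (psr_pow2_leq H h01 (leq_addl k l)).
  exact: psr_trans le1 hl.
rewrite -[_ ^+ _]mulr1; apply: (psr_pow2_leq H h01 (leq_addr l k)).
exact: psr_trans lex hk.
Qed.

Section StrassenLike.
Variables (S : comPzSemiRingType) (le : S -> S -> Prop).
Hypothesis sl : strassen_like le.
Let H := sl_psr sl.
Let h01 := sl_ge0 sl.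

Lemma sl_neq10 : (1 : S) <> 0.
Proof. by move=> e; apply: (sl_10 sl); rewrite e; exact: psr_refl. Qed.

Lemma sl_le0 x : le x 0 -> x = 0.
Proof.
move=> x0; apply: contrapT => /(sl_bound sl)[k [hk _]].
apply: (sl_10 sl); apply: (psr_trans H hk).
by have := psr_mul H (2%:R ^+ k) x0; rewrite mulr0.
Qed.

Lemma sl_mul_neq0 (x y : S) : x <> 0 -> y <> 0 -> x * y <> 0.
Proof.
move=> /(sl_bound sl)[k [hk _]] /(sl_bound sl)[l [hl _]] xy.
apply: (sl_10 sl); have := psr_pow2_mul H hk hl.
by rewrite xy mulr0 mulr1.
Qed.

Lemma sl_exp_neq0 n (x : S) : x <> 0 -> x ^+ n <> 0.
Proof.
move=> x0; elim: n => [|n IHn]; first by rewrite expr0; exact: sl_neq10.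
by rewrite exprS; exact: sl_mul_neq0.
Qed.


Lemma sl_dominates (x y : S) : y <> 0 -> exists k, le x (2%:R ^+ k * y).
Proof.
move=> /(sl_bound sl)[k [hk _]]; have [->|/eqP x0] := eqVneq x 0.
  by exists 0%N; exact: psr_ge0.
have [l [_ hl]] := sl_bound sl x0; exists (l + k)%N.
by apply: (psr_pow2_trans H _ hk); rewrite mulr1.
Qed.

Lemma sl_exp_dominates e (x y : S) : y <> 0 -> exists K, forall r, (r < e)%N ->
  le (x ^+ r) (2%:R ^+ K * y ^+ r).
Proof.
move=> y0; elim: e => [|e [K hK]]; first by exists 0%N.
have [k hk] := sl_dominates (x ^+ e) (sl_exp_neq0 (n := e) y0).
exists (K + k)%N => r; rewrite ltnS leq_eqVlt => /orP[/eqP->|/hK h].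
  exact: (psr_pow2_leq H h01 (leq_addl K k) hk).
exact: (psr_pow2_leq H h01 (leq_addr k K) h).
Qed.

End StrassenLike.

(** The relation [asymp_le] between [geom x] and [geom y] freed from sublinear sequences: every
    slope [1/p] is allowed at the price of a constant [K]. The equivalence is [geo_leP]. *)
Definition geo_le (S : comPzSemiRingType) (le : S -> S -> Prop) (x y : S) :=
  forall p, (0 < p)%N -> exists K, forall n,
    le (x ^+ n) (2%:R ^+ (n %/ p + K) * y ^+ n).

Section GeoLe.
Variables (S : comPzSemiRingType) (le : S -> S -> Prop).
Hypothesis sl : strassen_like le.
Let H := sl_psr sl.
Let h01 := sl_ge0 sl.

(** One exponent [e] with small ratio [q/e] is enough for a slope: dividing [n] by [e] raises the
    bound to the power [n %/ e], and the finitely many remainders cost one constant. *)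
Lemma geo_le_root x y :
  (forall p, exists e q, [/\ (0 < e)%N, (p * q <= e)%N &
     le (x ^+ e) (2%:R ^+ q * y ^+ e)]) ->
  geo_le le x y.
Proof.
move=> h p p0.
have [y0|/eqP y0] := eqVneq y 0.
  have [e [q [e0 _]]] := h p.
  rewrite y0 expr0n (gtn_eqF e0) mulr0 => /(sl_le0 sl) xe.
  have -> : x = 0 by apply: contrapT => /(sl_exp_neq0 sl (n := e)).
  exists 0%N => n; apply: (psr_pow2_leq H h01 (leq0n _)).
  by rewrite expr0 mul1r; exact: psr_refl.
have [e [q [e0 pq le_e]]] := h p.
have [K hK] := sl_exp_dominates sl e x y0.
exists K => n.
have split_exp (z : S) : z ^+ n = z ^+ (n %% e) * (z ^+ e) ^+ (n %/ e).
  by rewrite {1}(divn_eq n e) addnC exprD mulnC exprM.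
rewrite !split_exp.
have h1 := psr_pow2_exp H (n %/ e) le_e.
have h2 := hK _ (ltn_pmod n e0).
apply: (psr_pow2_leq H h01) (psr_pow2_mul H h2 h1).
rewrite addnC leq_add2r leq_divRL //.
apply: leq_trans (leq_trunc_div n e).
by rewrite mulnAC (mulnC q) mulnC leq_mul2l pq orbT.
Qed.

Lemma geo_le_sub x y : le x y -> geo_le le x y.
Proof.
move=> xy p p0; exists 0%N => n.
by apply: (psr_pow2_leq H h01 (leq0n _)); rewrite expr0 mul1r; exact: psr_exp.
Qed.

Lemma geo_le_psr : preordered_semiring (geo_le le).
Proof.
split=> [x|x y z xy yz p p0|x y z xy p p0|x y z xy p p0].
- by apply: geo_le_sub; exact: psr_refl.
- have p20 : (0 < p.*2)%N by rewrite double_gt0.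
  have [K hK] := xy _ p20; have [L hL] := yz _ p20.
  exists (K + L)%N => n.
  apply: (psr_pow2_leq H h01) (psr_pow2_trans H (hK n) (hL n)).
  rewrite addnACA leq_add2r addnn -muln2 leq_divRL // -mulnA.
  by rewrite [(2 * _)%N]mulnC muln2 leq_trunc_div.
- have [K hK] := xy _ p0; exists K => n.
  rewrite !(exprDn z) mulr_sumr; apply: (psr_sum H) => j _.
  rewrite mulrnAr mulrCA; apply: (psr_muln H); apply: (psr_mul H).
  apply: (psr_pow2_leq H h01) (hK j).
  by rewrite leq_add2r leq_div2r // -ltnS.
- have [K hK] := xy _ p0; exists K => n.
  by rewrite !exprMn mulrCA; apply: (psr_mul H).
Qed.

End GeoLe.

(** * Strassen duality *)

Definition consistent (S : comPzSemiRingType) (le : S -> S -> Prop) : Prop :=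
  forall n : nat, ~ le n.+1%:R n%:R.

Lemma consistent_leq (S : comPzSemiRingType) (le : S -> S -> Prop) m n :
  preordered_semiring le -> le 0 1 -> consistent le ->
  le m%:R n%:R -> (m <= n)%N.
Proof.
move=> H h01 co mn; rewrite leqNgt; apply/negP => nm.
by apply: (co n); apply: psr_trans mn => //; exact: psr_leqn.
Qed.

(** Bernoulli's inequality [1 + k/n <= (1 + 1/n)^k], cleared of denominators. *)
Lemma expn_succ_ge n k : (n ^ k * (n + k) <= n.+1 ^ k * n)%N.
Proof.
elim: k => [|k IHk]; first by rewrite !expn0 addn0.
have : (n ^ k <= n.+1 ^ k)%N by case: (k) => [|j]; rewrite ?expn0 ?leq_exp2r.
rewrite !expnS; nia.
Qed.

(** The converse estimate [(1 + 1/n)^p <= 1 + 2p/n], cleared of denominators. *)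
Lemma expn_succ_le n p :
  (p.*2 <= n)%N -> (n.+1 ^ p * n <= n ^ p * (n + p.*2))%N.
Proof.
elim: p => [|p IHp] pn; first by rewrite !expn0 addn0.
have {IHp} := IHp (ltac:(lia)); rewrite !expnS; nia.
Qed.

Section Consistency.
Variables (S : comPzSemiRingType) (le : S -> S -> Prop).
Hypotheses (sl : strassen_like le) (co : consistent le).
Let H := sl_psr sl.
Let h01 := sl_ge0 sl.

Lemma geo_le_consistent : consistent (geo_le le).
Proof.
case=> [|n] h.
  have [K hK] := h 1%N isT; apply: (sl_10 sl).
  by have := hK 1%N; rewrite !expr1 mulr0n mulr0.
have n2 : (0 < n.+1.*2)%N by rewrite double_gt0.
have [K hK] := h _ n2.
have two_pow : (2 * n.+1 ^ n.+1 <= n.+2 ^ n.+1)%N.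
  by have := expn_succ_ge n.+1 n.+1; nia.
(* At this exponent the left side gains [2 ^ (2K + 2)], since [(1 + 1/(n+1))^(n+1) >= 2], while only
   [2 ^ (2K + 1)] is allowed. *)
have := hK (n.+1.*2 * K.+1)%N.
rewrite mulKn // -!natrX -natrM => /(consistent_leq H h01 co) le_n.
have : (2 ^ K.+1.*2 * n.+1 ^ (n.+1.*2 * K.+1) <= n.+2 ^ (n.+1.*2 * K.+1))%N.
  have -> : (n.+1.*2 * K.+1 = n.+1 * K.+1.*2)%N by lia.
  by rewrite !expnM -expnMn leq_exp2r // double_gt0.
move=> /leq_trans /(_ le_n); rewrite leq_mul2r expn_eq0 /= leq_exp2l //.
lia.
Qed.

(** The factor [s] acts as a catalyst: each of the [n] uses of the hypothesis gives it back. *)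
Lemma mul_exp_le s x y n : le (s * x) (s * y) -> le (s * x ^+ n) (s * y ^+ n).
Proof.
move=> xy; elim: n => [|n IHn]; first by rewrite !expr0; exact: psr_refl.
rewrite !exprS; apply: (psr_trans H (y := x * (s * y ^+ n))).
  by rewrite mulrCA; exact: psr_mul.
by rewrite mulrCA !mulrA -!(mulrC (y ^+ n)); exact: psr_mul.
Qed.

Lemma add_mul_le z a b n : le (z + a) (z + b) -> le (z + a *+ n) (z + b *+ n).
Proof.
move=> ab; elim: n => [|n IHn]; first by rewrite !mulr0n; exact: psr_refl.
rewrite !mulrS; apply: (psr_trans H (y := a + (z + b *+ n))).
  by rewrite addrCA; exact: psr_add.
by rewrite addrCA !addrA -!(addrC (b *+ n)); exact: psr_add.
Qed.

(** Repeating the hypothesis [N] times makes [z] negligible against [s * y *+ N], and taking powers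
    makes [s] negligible in turn, so both can be cancelled asymptotically. *)
Lemma cancel_geo_le z s x y :
  s <> 0 -> le (z + s * x) (z + s * y) -> geo_le le x y.
Proof.
move=> s0 hz.
have hN N := add_mul_le N hz.
have [y0|/eqP y0] := eqVneq y 0.
  have [->|/eqP x0] := eqVneq x 0.
    by rewrite y0; apply: geo_le_sub => //; exact: psr_refl.
  (* With [y = 0] all multiples of [s * x] stay below [z]. As [1 <= 2^k s x] and [z <= 2^l], taking
     [2^(k+l) + 1] copies contradicts consistency. *)
  have [k hk] := sl_dominates sl 1 (sl_mul_neq0 sl s0 x0).
  have [l hl] := sl_dominates sl z (sl_neq10 sl).
  have := hN (2 ^ (k + l)).+1%N; rewrite y0 mulr0 mul0rn addr0.
  set N := (_.+1)%N => hz'.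
  suff /(consistent_leq H h01 co) : le N%:R (2 ^ (k + l))%:R by rewrite ltnn.
  have h1 := psr_muln H N hk; rewrite natrX exprD.
  apply: (psr_trans H h1); rewrite -mulrnAr; apply: (psr_mul H).
  rewrite -[2%:R ^+ l]mulr1; apply: psr_trans hl => //.
  apply: psr_trans hz' => //.
  by rewrite addrC; exact: psr_addr.
have [k hk] := sl_dominates sl z (sl_mul_neq0 sl s0 y0).
have {}hN N : le (s * (x *+ N)) (s * (y *+ (N + 2 ^ k))).
  rewrite !mulrnAr; apply: (psr_trans H (y := z + (s * x) *+ N)).
    by rewrite addrC; exact: psr_addr.
  apply: (psr_trans H (hN N)); rewrite addrC mulrnDr.
  by apply: psr_add => //; rewrite -mulr_natl natrX.
apply: geo_le_root => // P.
(* This [N] turns [((N + 2^k) / N)^p] into [(1 + 1/(2p))^p], which is at most 2: passing from [x] to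
   [x ^+ p] costs a single factor 2. *)
pose p := P.*2.+1; pose N := (p.*2 * 2 ^ k)%N.
have M0 : (0 < N ^ p)%N by rewrite expn_gt0 muln_gt0 expn_gt0.
have hM : ((N + 2 ^ k) ^ p <= 2 * N ^ p)%N.
  rewrite /N -mulSnr !expnMn mulnA leq_mul2r; apply/orP; right.
  by have := expn_succ_le (leqnn p.*2); nia.
pose T := s *+ (N ^ p).
have T0 : T <> 0.
  move=> T0; apply: s0; apply: (sl_le0 sl); rewrite -T0.
  exact: (@psr_leqn _ _ H h01 1).
have hT : le (T * x ^+ p) (T * (2%:R * y ^+ p)).
  have := mul_exp_le p (hN N); rewrite !exprMn_n.
  rewrite /T mulrnAl -mulrnAr => /(psr_trans H); apply.
  rewrite mulr_natl mulrnAl -mulrnAr -mulrnA.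
  by apply: (psr_mul H); exact: psr_leqn.
have [a ha] := sl_dominates sl 1 T0.
have [b hb] := sl_dominates sl T (sl_neq10 sl).
(* Removing [T] on both sides costs [2^(a+b)]. With [n > a + b] the total exponent is below [2n],
   and [P * 2n <= p * n]. *)
pose n := (a + b).+1; exists (p * n)%N, (a + b + n)%N; split.
- by rewrite muln_gt0.
- by rewrite /p /n; nia.
rewrite !(exprM _ p n) exprD -mulrA -exprMn.
apply: (psr_trans H (y := 2%:R ^+ a * (T * (x ^+ p) ^+ n))).
  rewrite mulrA -[X in le X _]mul1r -!(mulrC ((x ^+ p) ^+ n)); exact: psr_mul.
rewrite exprD -mulrA; apply: (psr_mul H).
apply: (psr_trans H (mul_exp_le n hT)).
rewrite -!(mulrC ((_ * y ^+ p) ^+ n)); apply: (psr_mul H).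
by rewrite -[2%:R ^+ b]mulr1.
Qed.
End Consistency.

(** The comparison that becomes true is [y <= x], in this direction. The formula is the formal
    inequality [a - b <= s (y - x)] with the negative terms moved across. *)
Definition adjoin (S : comPzSemiRingType) (le : S -> S -> Prop) (x y a b : S) :=
  exists s, le (a + s * x) (b + s * y).

Section Adjoin.
Variables (S : comPzSemiRingType) (le : S -> S -> Prop).
Hypothesis H : preordered_semiring le.

Lemma adjoin_psr x y : preordered_semiring (adjoin le x y).
Proof.
split=> [a|a b c [s hs] [t ht]|a b c [s hs]|a b c [s hs]].
- by exists 0; rewrite !mul0r; exact: psr_refl.
- exists (s + t); rewrite !mulrDl.
  apply: (psr_trans H (y := b + t * x + s * y)).
    by rewrite addrA -[b + _ + _]addrAC -!(addrC (t * x)); exact: psr_add.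
  by rewrite [s * y + _]addrC addrA -!(addrC (s * y)); exact: psr_add.
- by exists s; rewrite -!addrA; exact: psr_add.
- by exists (c * s); rewrite -!mulrA -!mulrDr; exact: psr_mul.
Qed.

Lemma adjoin_sub x y a b : le a b -> adjoin le x y a b.
Proof. by exists 0; rewrite !mul0r !addr0. Qed.

Lemma adjoin_le x y : adjoin le x y y x.
Proof. by exists 1; rewrite !mul1r addrC; exact: psr_refl. Qed.

End Adjoin.

(** * Extending a consistent preorder to a maximal one *)

Section Maximal.
Variables (S : comPzSemiRingType) (le : S -> S -> Prop).
Hypotheses (sl : strassen_like le) (co : consistent le).

(** A violation reads [n + 1 + s x <= n + s y]. Dropping the 1 leaves a comparison from which [n]
    and [s] cancel, unless [s = 0], when [le] itself would be inconsistent. *)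
Lemma adjoin_consistent (x y : S) :
  ~ geo_le le x y -> consistent (adjoin le x y).
Proof.
move=> nxy n [s hs]; apply: nxy.
have [s0|/eqP s0] := eqVneq s 0.
  by case: (co (n := n)); move: hs; rewrite s0 !mul0r !addr0.
apply: (cancel_geo_le sl co (z := n%:R) s0).
apply: psr_trans (sl_psr sl) _ _ _ _ hs.
rewrite mulrSr -addrA [1 + _]addrC addrA.
by apply: psr_addr; [exact: sl|exact: sl_ge0].
Qed.

Lemma extension_strassen_like (Q : S -> S -> Prop) :
  preordered_semiring Q -> (forall x y, le x y -> Q x y) -> consistent Q ->
  strassen_like Q.
Proof.
move=> HQ leQ coQ; split=> //; first by apply: leQ; exact: sl_ge0.
  exact: (coQ 0%N).
by move=> x /(sl_bound sl)[k [h1 h2]]; exists k; split; exact: leQ.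
Qed.

Lemma maximal_extension : exists Q : S -> S -> Prop,
  [/\ preordered_semiring Q, forall x y, le x y -> Q x y, consistent Q &
    forall Q', preordered_semiring Q' -> (forall x y, Q x y -> Q' x y) ->
      consistent Q' -> forall x y, Q' x y -> Q x y].
Proof.
pose E (Q : S -> S -> Prop) :=
  [/\ preordered_semiring Q, forall x y, le x y -> Q x y & consistent Q].
have E0 : E le by split=> //; exact: sl_psr.
pose r (t s : {Q | E Q}) := `[< forall x y, sval t x y -> sval s x y >].
have [| | |[Q [HQ leQ coQ]] maxQ] := @ZL_preorder {Q | E Q} (exist _ le E0) r.
- by move=> t; apply/asboolP.
- move=> a b c /asboolP ab /asboolP bc; apply/asboolP => x y ?.
  by apply: bc; exact: ab.
- move=> A totA; have [[t At]|A0] := pselect (exists t, A t); last first.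
    by exists (exist _ le E0) => s As; case: A0; exists s.
  (* The union of a nonempty chain stays consistent because a violation already occurs in a single
     member. *)
  pose U x y := exists2 t, A t & sval t x y.
  have EU : E U.
    split.
    - split=> [x|x y z [a Aa xy] [b Ab yz]|x y z [a Aa xy]|x y z [a Aa xy]].
      + by exists t => //; apply: psr_refl; case: (svalP t).
      + have [/asboolP ab|/asboolP ba] := totA _ _ Aa Ab.
          exists b => //; have [Hb _ _] := svalP b.
          by apply: psr_trans yz => //; exact: ab.
        exists a => //; have [Ha _ _] := svalP a.
        by apply: psr_trans xy _ => //; exact: ba.
      + by exists a => //; have [Ha _ _] := svalP a; exact: psr_add.
      + by exists a => //; have [Ha _ _] := svalP a; exact: psr_mul.
    - by move=> x y xy; exists t => //; have [_ h _] := svalP t; exact: h.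
    - by move=> n [a Aa]; have [_ _ h] := svalP a; exact: h.
  by exists (exist _ U EU) => s As; apply/asboolP => x y xy; exists s.
exists Q; split=> // Q' HQ' QQ' coQ'.
have EQ' : E Q' by split=> // x y /leQ /QQ'.
by have /asboolP := maxQ (exist _ Q' EQ') (introT (asboolP _) QQ').
Qed.

End Maximal.

(** A maximal [Q] contains its own consistent extension [geo_le Q]. So if [Q x y] fails, adjoining
    [y <= x] is consistent, and by maximality it was present before. *)
Lemma total_extension (S : comPzSemiRingType) (le : S -> S -> Prop) :
  strassen_like le -> consistent le -> exists Q : S -> S -> Prop,
  [/\ strassen_like Q, forall x y, le x y -> Q x y, consistent Q &
    forall x y, Q x y \/ Q y x].
Proof.
move=> sl co; have [Q [HQ leQ coQ maxQ]] := maximal_extension sl co.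
have slQ := extension_strassen_like sl HQ leQ coQ.
exists Q; split=> // x y.
have [xy|nxy] := pselect (geo_le Q x y).
  left; apply: maxQ xy; first exact: geo_le_psr.
    by move=> a b; exact: geo_le_sub.
  exact: geo_le_consistent.
right; apply: (maxQ (adjoin Q x y)); first exact: adjoin_psr.
- by move=> a b; exact: adjoin_sub.
- exact: adjoin_consistent.
- exact: adjoin_le.
Qed.

Lemma archi_le (R : archiRealFieldType) (a b c : R) :
  (forall n, (0 < n)%N -> a * n%:R <= b * n%:R + c) -> a <= b.
Proof.
move=> h; rewrite leNgt; apply/negP => ba.
have ab0 : 0 < a - b by rewrite subr_gt0.
have := h _ (ltn0Sn (Num.truncn (c / (a - b)))).
rewrite -lerBlDl -mulrBl leNgt => /negP; apply.
by rewrite [X in _ < X]mulrC -ltr_pdivrMr // Num.Theory.truncnS_gt.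
Qed.

(** * The real-valued homomorphism of a total consistent preorder *)

Section Character.
Variables (R : realType) (S : comPzSemiRingType) (le : S -> S -> Prop).
Hypotheses (sl : strassen_like le) (co : consistent le).
Let H := sl_psr sl.
Let h01 := sl_ge0 sl.

(** The lower cut of [x] among the rationals, where [m/n <= x] is expressed in [S] by [m <= n x]. *)
Definition character (x : S) : R := sup [set r : R |
  exists m n, [/\ (0 < n)%N, le m%:R (x *+ n) & r = m%:R / n%:R]].

Lemma ratio_leq x m n m' n' :
  le m%:R (x *+ n) -> le (x *+ n') m'%:R -> (m * n' <= m' * n)%N.
Proof.
move=> /(psr_muln H n') h1 /(psr_muln H n) h2.
rewrite -!mulrnA in h1 h2; apply: (consistent_leq H h01 co).
by apply: (psr_trans H h1); rewrite [(n * n')%N]mulnC.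
Qed.

Lemma nat_upper (x : S) : exists m, le x m%:R.
Proof.
have [k hk] := sl_dominates sl x (sl_neq10 sl).
by exists (2 ^ k)%N; rewrite natrX -[_ ^+ _]mulr1.
Qed.

Lemma character_ub x m n : (0 < n)%N -> le (x *+ n) m%:R ->
  ubound [set r : R | exists m n,
    [/\ (0 < n)%N, le m%:R (x *+ n) & r = m%:R / n%:R]] (m%:R / n%:R).
Proof.
move=> n0 hx _ [m' [n' [n'0 hx' ->]]].
rewrite ler_pdivrMr ?ltr0n // mulrAC ler_pdivlMr ?ltr0n //.
by rewrite -!natrM ler_nat; exact: ratio_leq hx' hx.
Qed.

Lemma character_ge x m n : (0 < n)%N -> le m%:R (x *+ n) ->
  m%:R <= character x * n%:R.
Proof.
move=> n0 hx; rewrite -ler_pdivrMr ?ltr0n //; apply: ub_le_sup.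
  have [k hk] := nat_upper x; exists (k%:R / 1%:R).
  by apply: character_ub; rewrite ?mulr1n.
by exists m, n.
Qed.

Lemma character_le x m n : (0 < n)%N -> le (x *+ n) m%:R ->
  character x * n%:R <= m%:R.
Proof.
move=> n0 hx; rewrite -ler_pdivlMr ?ltr0n //; apply: ge_sup.
  by exists (0 / 1), 0%N, 1%N; split=> //; exact: psr_ge0.
exact: character_ub.
Qed.

Hypothesis tot : forall x y, le x y \/ le y x.

(** The integer part of [x]. Totality turns the failure of [m + 1 <= x] into [x <= m + 1]. *)
Lemma nat_bracket (x : S) : exists m, le m%:R x /\ le x m.+1%:R.
Proof.
have exm : exists m, `[< ~ le m%:R x >].
  have [m hm] := nat_upper x; exists m.+1; apply/asboolP => h.
  by apply: (co (n := m)); exact: psr_trans h hm.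
have [[|m] /asboolP nm minm] := ex_minnP exm.
  by case: nm; exact: psr_ge0.
exists m; split; last by have [|//] := tot m.+1%:R x.
by apply: contrapT => h; have := minm m (introT (asboolP _) h); rewrite ltnn.
Qed.

Lemma character_bracket x n : (0 < n)%N -> exists m,
  [/\ le m%:R (x *+ n), le (x *+ n) m.+1%:R,
      m%:R <= character x * n%:R & character x * n%:R <= m%:R + 1].
Proof.
move=> n0; have [m [h1 h2]] := nat_bracket (x *+ n); exists m; split=> //.
  exact: character_ge.
by rewrite natr1; exact: character_le.
Qed.

Lemma character_homo x y : le x y -> character x <= character y.
Proof.
move=> xy; apply: (@archi_le _ _ _ 1) => n n0.
have [m [h1 _ _ h]] := character_bracket x n0.
apply: (le_trans h); rewrite lerD2r; apply: character_ge => //.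
by apply: (psr_trans H h1); exact: psr_muln.
Qed.

Lemma character_nat k : character k%:R = k%:R.
Proof.
apply/le_anti/andP; split.
  have := @character_le k%:R k 1 isT; rewrite mulr1n mulr1; apply.
  exact: psr_refl.
have := @character_ge k%:R k 1 isT; rewrite mulr1n mulr1; apply.
exact: psr_refl.
Qed.

Lemma character_ge0 x : 0 <= character x.
Proof.
by rewrite -[0](character_nat 0); apply: character_homo; exact: psr_ge0.
Qed.

Lemma character_gt0 x : x <> 0 -> 0 < character x.
Proof.
move=> /(sl_bound sl)[k [hk _]].
have k0 : (0 < 2 ^ k)%N by rewrite expn_gt0.
have hk1 : le 1%:R (x *+ 2 ^ k) by rewrite -(mulr_natl x) natrX.
have := character_ge k0 hk1.
by move=> /(lt_le_trans ltr01); rewrite pmulr_lgt0 // ltr0n.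
Qed.

Lemma characterD x y : character (x + y) = character x + character y.
Proof.
apply/le_anti/andP; split; apply: (@archi_le _ _ _ 2) => n n0;
  have [m [h1 h2 h3 h4]] := character_bracket x n0;
  have [m' [h1' h2' h3' h4']] := character_bracket y n0.
  have := @character_le (x + y) (m.+1 + m'.+1) n n0.
  rewrite mulrnDl natrD => /(_ (psr_add2 H h2 h2')) h5.
  by rewrite natrD -!natr1 in h5; lra.
have := @character_ge (x + y) (m + m') n n0.
rewrite mulrnDl natrD => /(_ (psr_add2 H h1 h1')) h5.
by rewrite natrD in h5; lra.
Qed.

(** Multiplying the integer parts of [n x] and [n y] gives the value at [n^2 x y] with an error
    linear in [n]. Division by [n] leaves a bounded error, which [archi_le] removes. *)
Lemma characterM x y : character (x * y) = character x * character y.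
Proof.
have x0 := character_ge0 x; have y0 := character_ge0 y.
have sqn n : x *+ n * (y *+ n) = x * y *+ (n * n).
  by rewrite mulrnAl mulrnAr mulrnA.
apply/le_anti/andP; split;
  apply: (@archi_le _ _ _ (character x + character y + 1)) => n n0;
  have [m [h1 h2 h3 h4]] := character_bracket x n0;
  have [m' [h1' h2' h3' h4']] := character_bracket y n0;
  have nn0 : (0 < n * n)%N by rewrite muln_gt0 n0.
  have := @character_le (x * y) (m.+1 * m'.+1) (n * n) nn0.
  have := psr_mul2 H h2 h2'; rewrite -natrM sqn => h /(_ h).
  rewrite !natrM -!natr1 => h5.
  have n1 : 1 <= n%:R :> R by rewrite ler1n.
  have h6 : (m%:R + 1) * (m'%:R + 1) <=
      (character x * n%:R + 1) * (character y * n%:R + 1).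
    by apply: ler_pM; rewrite ?addr_ge0 ?ler0n ?lerD2r.
  rewrite -(ler_pM2r (lt_le_trans ltr01 n1)).
  by have h7 := le_trans h5 h6; lra.
have := @character_ge (x * y) (m * m') (n * n) nn0.
have := psr_mul2 H h1 h1'; rewrite -natrM sqn => h /(_ h).
rewrite !natrM => h5.
have n1 : 1 <= n%:R :> R by rewrite ler1n.
have h6 : character x * n%:R * (character y * n%:R) <=
    (m%:R + 1) * (m'%:R + 1).
  by apply: ler_pM; rewrite ?mulr_ge0.
rewrite -(ler_pM2r (lt_le_trans ltr01 n1)).
by lra.
Qed.

End Character.

(** * The semiring of nonnegative reals *)

(** The nonnegative reals as a type of their own, so that they can carry a semiring structure and be
    a target in the universal property. *)
Record nnreal (R : realType) := NNReal { nnval : R; nnval_ge0 : 0 <= nnval }.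

Section NNRealSemiring.
Variable R : realType.

HB.instance Definition _ := [isSub for @nnval R].
HB.instance Definition _ := [Choice of nnreal R by <:].

Lemma nneg_semiring_closed : semiring_closed (fun x : R => 0 <= x).
Proof.
split; first by split=> [|x y]; [exact: lexx|exact: addr_ge0].
by split=> [|x y]; [exact: ler01|exact: mulr_ge0].
Qed.

HB.instance Definition _ := GRing.SubChoice_isSubComPzSemiRing.Build R
  (fun x : R => 0 <= x) (nnreal R) nneg_semiring_closed.

Lemma nnval0 : nnval (0 : nnreal R) = 0. Proof. exact: rmorph0 val. Qed.
Lemma nnval1 : nnval (1 : nnreal R) = 1. Proof. exact: rmorph1 val. Qed.
Lemma nnvalD (x y : nnreal R) : nnval (x + y) = nnval x + nnval y.
Proof. exact: (rmorphD val). Qed.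
Lemma nnvalM (x y : nnreal R) : nnval (x * y) = nnval x * nnval y.
Proof. exact: (rmorphM val). Qed.
Lemma nnvalX n (x : nnreal R) : nnval (x ^+ n) = nnval x ^+ n.
Proof. exact: (rmorphXn val). Qed.
Lemma nnvalMn n (x : nnreal R) : nnval (x *+ n) = nnval x *+ n.
Proof. exact: (rmorphMn val). Qed.

End NNRealSemiring.

(** * Sublinearity in integer arithmetic *)

Lemma sublinearP (k : nat -> nat) :
  sublinear k <-> forall p, exists N, forall n, (N <= n)%N -> (p * k n <= n)%N.
Proof.
split=> [/cvgrPdist_lt h p|h].
  have p0 : 0 < (p.+1%:R^-1 : rat) by rewrite invr_gt0 ltr0n.
  (* The maximum with 1 avoids the division by zero at [n = 0]. *)
  have [N _ hN] := h _ p0; exists (maxn N 1) => n.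
  rewrite geq_max => /andP[Nn n0].
  have := hN n Nn; rewrite sub0r normrN ger0_norm ?divr_ge0 ?ler0n//.
  rewrite ltr_pdivrMr ?ltr0n// ltr_pdivlMl ?ltr0n//.
  by rewrite -natrM ltr_nat => h1; rewrite mulSn in h1; lia.
apply/cvgrPdist_lt => e e0.
have [N hN] := h (Num.truncn e^-1).+1.
exists N.+1 => // n /= Nn.
have n0 : (0 < n)%N by lia.
rewrite sub0r normrN ger0_norm ?divr_ge0 ?ler0n//.
rewrite ltr_pdivrMr ?ltr0n//.
have := hN n (ltnW Nn); rewrite -(ler_nat rat) natrM => h1.
have := truncnS_gt e^-1; set T := _.+1 in h1 * => h2.
have h3 : 1 < e * T%:R by rewrite -ltr_pdivrMl // mulr1.
have [->|k0] := posnP (k n); first by rewrite mulr_gt0 // ltr0n.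
apply: (lt_le_trans (y := e * T%:R * (k n)%:R)).
  by rewrite ltr_pMl // ltr0n.
by rewrite -mulrA ler_pM2l.
Qed.

Lemma sublinear_add (k l : nat -> nat) :
  sublinear k -> sublinear l -> sublinear (fun n => k n + l n)%N.
Proof.
move=> /sublinearP hk /sublinearP hl; apply/sublinearP => p.
have [N hN] := hk p.*2; have [M hM] := hl p.*2.
exists (maxn N M) => n; rewrite geq_max => /andP[/hN h1 /hM h2]; nia.
Qed.

Lemma sublinear_div (k : nat -> nat) p : sublinear k -> (0 < p)%N ->
  exists K, forall n, (k n <= n %/ p + K)%N.
Proof.
move=> /sublinearP /(_ p)[N hN] p0.
have [K hK] : exists K, forall n, (n < N)%N -> (k n <= K)%N.
  elim: N {hN} => [|N [K hK]]; first by exists 0%N.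
  exists (maxn K (k N)) => n; rewrite ltnS leq_eqVlt leq_max.
  by case/orP => [/eqP->|/hK ->]; rewrite ?leqnn ?orbT.
exists K => n; have [/hK h|/hN] := ltnP n N.
  exact: leq_trans h (leq_addl _ _).
rewrite mulnC -leq_divRL // => h; exact: leq_trans h (leq_addr _ _).
Qed.

Lemma geo_leP (S : comPzSemiRingType) (le : S -> S -> Prop) x y :
  preordered_semiring le -> le 0 1 ->
  asymp_le le 2%:R (geom x) (geom y) <-> geo_le le x y.
Proof.
move=> H h01; split=> [[k hk le_k] p p0|h].
  have [K hK] := sublinear_div hk p0.
  by exists K => n; exact: (psr_pow2_leq H h01 (hK n) (le_k n)).
have exk n : exists j, `[< le (x ^+ n) (2%:R ^+ j * y ^+ n) >].
  have [K hK] := h 1%N isT; exists (n %/ 1 + K)%N; exact/asboolP.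
exists (fun n => ex_minn (exk n)); last first.
  by move=> n; case: ex_minnP => j /asboolP.
apply/sublinearP => p.
(* Half of [n] pays for the slope [1/(2(p+1))] taken [p] times, and the other half for [p * K] once
   [n >= 2pK]. *)
have [K hK] := h p.+1.*2 isT; exists (p.*2 * K)%N => n Kn.
case: ex_minnP => j _ /(_ _ (introT (asboolP _) (hK n))) jn.
have := leq_trunc_div n p.+1.*2; nia.
Qed.

Lemma root_ex (R : realType) (r : R) n :
  (0 < n)%N -> 0 <= r -> exists2 c, 0 <= c & c ^+ n = r.
Proof.
move=> n0 r0; exists (r `^ n%:R^-1); first exact: powR_ge0.
rewrite -powR_mulrn ?powR_ge0 // -powRrM mulVf ?powRr1 //.
by rewrite pnatr_eq0 -lt0n.
Qed.

Lemma ler_rootX (R : realType) n (x y : R) :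
  (0 < n)%N -> 0 <= x -> 0 <= y -> x ^+ n <= y ^+ n -> x <= y.
Proof. by move=> n0 x0 y0; rewrite ler_pXn2r. Qed.

(* A pair [(r, n)] stands for the number [r^(1/n)]: the lemma is the
   existence of a cut between two families of radicals. *)
Lemma radical_cut (R : realType) (A B : R -> nat -> Prop) :
  (forall r n, A r n -> 0 <= r /\ (0 < n)%N) ->
  (forall t m, B t m -> 0 <= t /\ (0 < m)%N) ->
  (exists t m, B t m) ->
  (forall r n t m, A r n -> B t m -> r ^+ m <= t ^+ n) ->
  exists z, [/\ 0 <= z, forall r n, A r n -> r <= z ^+ n &
                forall t m, B t m -> z ^+ m <= t].
Proof.
move=> hA hB [t0 [m0 B0]] AB.
pose E := [set c : R | 0 <= c /\ forall t m, B t m -> c ^+ m <= t]%classic.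
have Eub t m d : B t m -> 0 <= d -> d ^+ m = t -> ubound E d.
  move=> Bt d0 dm c [c0 hc]; have [_ m_gt0] := hB _ _ Bt.
  by apply: (ler_rootX m_gt0) => //; rewrite dm; exact: hc.
have E0 : E 0.
  by split=> // t m Bt; have [t_ge0 m_gt0] := hB _ _ Bt; rewrite expr0n gtn_eqF.
have supE : has_sup E.
  split; first by exists 0.
  have [t0_ge0 m0_gt0] := hB _ _ B0.
  by have [d d0 dm] := root_ex m0_gt0 t0_ge0; exists d; exact: Eub dm.
have z0 : 0 <= sup E by apply: ub_le_sup => //; exact: supE.2.
exists (sup E); split=> // [r n Ar|t m Bt].
  have [r0 n0] := hA _ _ Ar; have [c c0 cn] := root_ex n0 r0.
  rewrite -cn lerXn2r ?nnegrE //; apply: ub_le_sup; first exact: supE.2.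
  split=> // t m Bt; have [t_ge0 m_gt0] := hB _ _ Bt.
  apply: (ler_rootX n0) => //; first exact: exprn_ge0.
  by rewrite exprAC cn; exact: AB.
have [t_ge0 m_gt0] := hB _ _ Bt; have [d d0 dm] := root_ex m_gt0 t_ge0.
rewrite -dm lerXn2r ?nnegrE //; apply: ge_sup; first by exists 0.
exact: Eub dm.
Qed.

Definition nnle (R : realType) (x y : nnreal R) : Prop := nnval x <= nnval y.

(** * The nonnegative reals are closed and asymptotically complete *)

Section NNReal.
Variable R : realType.
Local Notation le := (@nnle R).

Lemma nnval_inj : injective (@nnval R).
Proof. exact: val_inj. Qed.

Lemma nnreal_po : partially_ordered_semiring le.
Proof.
split; last by move=> x y xy yx; apply/nnval_inj/le_anti; rewrite xy yx.
split=> [x|x y z|x y z xy|x y z xy]; rewrite /nnle ?nnvalD ?nnvalM //.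
- exact: le_trans.
- by rewrite lerD2l.
- by rewrite ler_wpM2l ?nnval_ge0.
Qed.

Lemma nnval_pow2 k (y : nnreal R) : nnval (2%:R ^+ k * y) = 2%:R ^+ k * nnval y.
Proof. by rewrite nnvalM nnvalX nnvalMn nnval1. Qed.

Lemma nnreal_power_universal : power_universal le 2%:R.
Proof.
split=> [/(congr1 (@nnval R))||x y x0 _ _].
- by rewrite nnvalMn nnval1 nnval0 => /eqP; rewrite pnatr_eq0.
- by rewrite /nnle nnvalMn nnval1 ler1n.
have {}x0 : 0 < nnval x.
  rewrite lt_neqAle nnval_ge0 andbT eq_sym; apply/eqP => e.
  by apply: x0; apply: nnval_inj; rewrite nnval0.
exists (Num.truncn (nnval y / nnval x)).+1.
rewrite /nnle nnval_pow2 -ler_pdivrMr //.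
apply/ltW/(lt_le_trans (truncnS_gt _)).
by rewrite -natrX ler_nat ltnW // ltn_expl.
Qed.

Lemma nnreal_strassen_like : strassen_like le.
Proof.
apply: power_universal_strassen_like nnreal_power_universal.
- by have [] := nnreal_po.
- by rewrite /nnle nnval0 nnval1 ler01.
- by rewrite /nnle nnval0 nnval1 ler10.
Qed.

(** If [y < x], some power [p] of the ratio is at least 4 by Bernoulli. At exponent [p (K + 1)] the
    ratio then reaches [2^(2K+2)], beyond the allowed [2^(2K+1)]. *)
Lemma nnreal_geo_le x y : geo_le le x y -> le x y.
Proof.
move=> h; rewrite /nnle leNgt; apply/negP => yx.
have x0 : 0 < nnval x by exact: le_lt_trans (nnval_ge0 y) yx.
have {}h p : (0 < p)%N -> exists K, forall n,
    nnval x ^+ n <= 2 ^+ (n %/ p + K) * nnval y ^+ n.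
  move=> /h[K hK]; exists K => n; have := hK n.
  by rewrite /nnle nnval_pow2 !nnvalX.
have y0 : 0 < nnval y.
  rewrite lt_neqAle nnval_ge0 andbT; apply/eqP => e.
  have [K /(_ 1%N)] := h 1%N isT.
  by rewrite -e !expr1 mulr0 leNgt x0.
have z1 : 0 < nnval x / nnval y - 1 by rewrite subr_gt0 ltr_pdivlMr // mul1r.
set z := nnval x / nnval y in z1.
pose p := (Num.truncn (4 / (z - 1))).+1.
have zp : 4 <= z ^+ p.
  have h1 : 4 <= p%:R * (z - 1).
    by rewrite -ler_pdivrMr //; apply/ltW/truncnS_gt.
  apply: (le_trans h1).
  suff h2 q : 1 + q%:R * (z - 1) <= z ^+ q.
    by apply: le_trans (h2 p); rewrite lerDr.
  elim: q => [|q IHq]; first by rewrite mul0r addr0 expr0.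
  rewrite exprS; apply: le_trans (ler_wpM2l _ IHq); last by lra.
  have : 0 <= q%:R * (z - 1) * (z - 1) by rewrite !mulr_ge0 ?ler0n //; lra.
  by rewrite -natr1; lra.
have [K /(_ (p * K.+1)%N)] := h p isT.
rewrite mulKn // -ler_pdivrMr ?exprn_gt0 // -expr_div_n exprM => h1.
have h2 : (4 : R) ^+ K.+1 <= (z ^+ p) ^+ K.+1.
  by rewrite lerXn2r ?nnegrE ?(le_trans _ zp).
have := le_trans h2 h1; rewrite -!natrX ler_nat.
rewrite -[4%N]/(2 ^ 2)%N -expnM leq_exp2l //.
lia.
Qed.

Lemma nnreal_closed : asymp_closed le 2%:R.
Proof.
move=> x y h; apply: nnreal_geo_le; apply/geo_leP => //.
  by have [] := nnreal_po.
exact: sl_ge0 nnreal_strassen_like.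
Qed.

(** The base plays the part of the limit of the [n]-th roots of [a n]. Taking all indices equal
    compares [a n ^+ m] and [a m ^+ n] through [a (m * n)], so the lower radicals, from
    [a n / 2 ^+ k n], stay below the upper ones, from [2 ^+ k n * a n], and [radical_cut]
    applies. *)
Lemma nnreal_complete : asymp_complete le 2%:R.
Proof.
move=> a a0 [[[k _ h] _]|[_ [k hk ak]]].
  have := h 1%N; rewrite [geom _ _]expr1 mulr0.
  move=> /(sl_le0 nnreal_strassen_like) a1.
  by case: (a0 1%N).
have ca n m :
    nnval (a n) ^+ m.+1 <= 2 ^+ (m.+1 * k n) * nnval (a (m.+1 * n)%N) /\
    nnval (a (m.+1 * n)%N) <= 2 ^+ (m.+1 * k n) * nnval (a n) ^+ m.+1.
  have := ak m.+1 (fun=> n) isT.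
  by rewrite /nnle prodr_const !sum_nat_const !card_ord !nnval_pow2 !nnvalX.
pose A r n := (0 < n)%N /\ r = nnval (a n) / 2 ^+ k n.
pose B r n := (0 < n)%N /\ r = 2 ^+ k n * nnval (a n).
have [r n [n0 ->]|r n [n0 ->]||r n t m [n0 ->] [m0 ->]|s [s0 As Bs]] :=
  @radical_cut R A B.
- by split=> //; rewrite divr_ge0 ?exprn_ge0 ?nnval_ge0.
- by split=> //; rewrite mulr_ge0 ?exprn_ge0 ?nnval_ge0.
- by exists (2 ^+ k 1%N * nnval (a 1%N)), 1%N.
- have [h1 _] := ca n m.-1; have [_ h2] := ca m n.-1.
  rewrite prednK // in h1; rewrite prednK // in h2.
  rewrite expr_div_n -exprM ler_pdivrMr ?exprn_gt0 // exprMn -exprM.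
  rewrite mulrC [(k n * m)%N]mulnC; apply: (le_trans h1).
  by rewrite ler_pM2l ?exprn_gt0 // [(k m * n)%N]mulnC [(m * n)%N]mulnC.
have a0_gt0 : 0 < nnval (a 0%N).
  rewrite lt_neqAle nnval_ge0 andbT eq_sym; apply/eqP => e.
  by apply: (a0 0%N); apply: nnval_inj; rewrite nnval0.
(* Index 0 belongs to neither family of radicals. Comparing [a 0] with its square bounds [a 0] and
   its inverse by [2^(2 k 0)], which is why [k] is doubled below. *)
have [c1 c2] := ca 0%N 1%N.
rewrite muln0 expr2 ler_pM2r // in c1.
rewrite muln0 expr2 mulrA -[leLHS]mul1r ler_pM2r // in c2.
have pow2 n c : 0 <= c -> c *+ 1 <= 2 ^+ k n * c.
  by move=> c0; rewrite mulr1n ler_peMl // exprn_ege1 // ler1n.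
exists (NNReal s0); split; exists (fun n => k n + k n)%N;
  try exact: sublinear_add.
  move=> n; rewrite [geom _ _]/(_ ^+ n) /nnle nnval_pow2 nnvalX /=.
  case: n => [|n]; first by rewrite expr0 mulr1 addnn -mul2n.
  have := As _ n.+1 (conj isT erefl); rewrite ler_pdivrMr ?exprn_gt0 // => h.
  apply: (le_trans h); rewrite mulrC exprD -mulrA -[leLHS]mulr1n.
  by apply: pow2; rewrite mulr_ge0 ?exprn_ge0.
move=> n; rewrite [geom _ _]/(_ ^+ n) /nnle nnval_pow2 nnvalX /=.
case: n => [|n]; first by rewrite expr0 addnn -mul2n.
apply: (le_trans (Bs _ n.+1 (conj isT erefl))).
rewrite exprD -mulrA -[leLHS]mulr1n.
by apply: pow2; rewrite mulr_ge0 ?exprn_ge0 ?nnval_ge0.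
Qed.

End NNReal.

Section CharacterMorphism.
Variables (R : realType) (S : comPzSemiRingType) (le : S -> S -> Prop).
Hypotheses (sl : strassen_like le) (co : consistent le).
Hypothesis tot : forall x y, le x y \/ le y x.

Definition nncharacter (x : S) : nnreal R :=
  NNReal (character_ge0 R sl co tot x).

Fact nncharacter_nmod : nmod_morphism nncharacter.
Proof.
split=> [|x y]; apply: nnval_inj.
  by rewrite nnval0 /= -[0]/(0%:R) character_nat.
by rewrite nnvalD /= characterD.
Qed.

Fact nncharacter_monoid : monoid_morphism nncharacter.
Proof.
split=> [|x y]; apply: nnval_inj.
  by rewrite nnval1 /= -[1]/(1%:R) character_nat.
by rewrite nnvalM /= characterM.
Qed.

HB.instance Definition _ :=
  GRing.isNmodMorphism.Build S (nnreal R) nncharacter nncharacter_nmod.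
HB.instance Definition _ :=
  GRing.isMonoidMorphism.Build S (nnreal R) nncharacter nncharacter_monoid.

End CharacterMorphism.

(** The factor 2 on [N]-th powers amounts to a factor [2^(1/N)] on the bases, and [N] is
    arbitrary. *)
Lemma geo_le_double (S : comPzSemiRingType) (le : S -> S -> Prop) x y :
  strassen_like le -> (forall N, geo_le le (x ^+ N) (2%:R * y ^+ N)) ->
  geo_le le x y.
Proof.
move=> sl h; apply: geo_le_root => // p.
have [K /(_ K.+1) hK] := h (3 * p.+1)%N 1%N isT.
exists (3 * p.+1 * K.+1)%N, (K.+1 + K + K.+1)%N; split; [by []|by nia|].
by rewrite divn1 exprMn mulrA -exprD -!exprM in hK.
Qed.

Lemma strassen_duality (R : realType) (S : comPzSemiRingType)
    (le : S -> S -> Prop) x y :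
  strassen_like le -> consistent le -> ~ geo_le le x y ->
  exists2 phi : {rmorphism S -> nnreal R},
    monotone_map le (@nnle R) phi & nnval (phi y) < nnval (phi x).
Proof.
move=> sl co nxy.
have [N nN] : exists N, ~ geo_le le (x ^+ N) (2%:R * y ^+ N).
  apply: contrapT => h; apply: nxy; apply: geo_le_double => // N.
  by apply: contrapT => h'; apply: h; exists N.
(* Adjoining [2 y^N <= x^N] instead of [y <= x] makes the separation by the character strict. *)
have coA := adjoin_consistent sl co nN.
have slA := extension_strassen_like sl (adjoin_psr (sl_psr sl) _ _)
  (@adjoin_sub _ _ _ _) coA.
have [Q [slQ AQ coQ totQ]] := total_extension slA coA.
have leQ a b : le a b -> Q a b by move=> ab; apply: AQ; exact: adjoin_sub.
exists (nncharacter R slQ coQ totQ).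
  by move=> a b ab; apply: character_homo => //; exact: leQ.
rewrite /= ltNge; apply/negP => xy.
have x0 : x <> 0.
  move=> x0; apply: nxy; apply: geo_le_sub => //; rewrite x0.
  by apply: psr_ge0; [exact: sl|exact: sl_ge0].
have : nnle (nncharacter R slQ coQ totQ (2%:R * y ^+ N))
            (nncharacter R slQ coQ totQ (x ^+ N)).
  by apply: character_homo => //; apply: AQ; apply: adjoin_le; exact: sl.
rewrite /nnle rmorphM rmorph_nat !rmorphXn nnvalM !nnvalX nnvalMn nnval1 /=.
have cx := character_gt0 R slQ coQ x0.
have cy := lt_le_trans cx xy.
have cxyN : character R Q x ^+ N <= character R Q y ^+ N.
  by apply: lerXn2r => //; rewrite nnegrE ltW.
rewrite leNgt => /negP; apply; apply: (le_lt_trans cxyN).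
by rewrite ltr_pMl ?exprn_gt0 // ltr1n.
Qed.

Lemma completion_reflects (R : realType) (S : comPzSemiRingType)
    (le : S -> S -> Prop) (Sbar : comPzSemiRingType)
    (lebar : Sbar -> Sbar -> Prop) (i : {rmorphism S -> Sbar}) x y :
  strassen_preorder le -> asymptotic_completion le 2%:R lebar i ->
  lebar (i x) (i y) -> geo_le le x y.
Proof.
move=> [H hn pu] hi xy; apply: contrapT => nxy.
have h01 : le 0 1 by apply/(hn 0%N 1%N).
have co : consistent le by move=> n /hn; rewrite ltnn.
have sl : strassen_like le.
  by apply: power_universal_strassen_like => //; exact: (co 0%N).
have [phi phi_mono] := strassen_duality R sl co nxy.
have [g [g_mono phi_g _]] := completion_univ hi (nnreal_po R)
  (nnreal_power_universal R) (@nnreal_closed R) (@nnreal_complete R) phi_mono.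
by rewrite !phi_g ltNge => /negP; apply; exact: g_mono.
Qed.

(** * Approximation of sums by powers of a representative *)

(** A polynomial over the naturals given by its list of exponents with repetition, so that monomials
    can be estimated and replaced one at a time. *)
Definition power_sum (A : pzSemiRingType) (s : seq nat) (x : A) : A :=
  \sum_(k <- s) x ^+ k.

Lemma power_sum_of_poly (p : {poly nat}) :
  exists s, forall (A : pzSemiRingType) (x : A),
  nat_poly_eval p x = power_sum s x.
Proof.
exists (flatten [seq nseq (p`_j)%R (nat_of_ord j) |
  j : 'I_(size p) <- enum 'I_(size p)]) => A x.
rewrite /power_sum big_flatten big_map big_enum; apply: eq_bigr => j _.
by rewrite big_nseq iter_addr_0.
Qed.

Lemma poly_of_power_sum s :
  exists p : {poly nat}, forall (A : pzSemiRingType) (x : A),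
  nat_poly_eval p x = power_sum s x.
Proof.
have [n sn] : exists n, all (fun k => k < n)%N s.
  exists (\max_(k <- s) k).+1; apply/allP => k ks.
  by rewrite ltnS leq_bigmax_seq.
exists (\poly_(j < n) count_mem j s) => A x; rewrite /nat_poly_eval.
pose F j := x ^+ j *+ ((\poly_(j < n) count_mem j s)`_j)%R.
rewrite (big_ord_widen n F (size_poly _ _)) big_mkcond.
transitivity (\sum_(j < n) x ^+ j *+ count_mem (val j) s).
  apply: eq_bigr => j _; rewrite /F; case: ltnP => [_|sj].
    by rewrite coef_poly ltn_ord.
  by have := nth_default 0 sj; rewrite coef_poly ltn_ord => ->; rewrite mulr0n.
elim: s sn {F} => [|k s IHs] /= => [_|/andP[kn /IHs {}IHs]].
  by rewrite /power_sum big_nil big1.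
rewrite /power_sum big_cons -[X in _ = _ + X]IHs.
under eq_bigr do rewrite mulrnDr.
rewrite big_split /=; congr (_ + _).
rewrite (bigD1 (Ordinal kn)) //= eqxx mulr1n big1 ?addr0 // => j jk.
case: eqP => [kj|_]; last by rewrite mulr0n.
by case/eqP: jk; apply: val_inj.
Qed.

(** The expansion [t] is the same in all semirings, and its degree, linear in [N], controls the
    error of replacing [x ^+ j] by [b ^+ (j %/ e)]. *)
Lemma power_sum_exp s N :
  exists2 t, {in t, forall k, k <= N * \max_(k <- s) k}%N &
  forall (A : pzSemiRingType) (x : A), power_sum s x ^+ N = power_sum t x.
Proof.
elim: N => [|N [t tN ht]].
  exists [:: 0%N]; first by move=> k; rewrite inE => /eqP ->.
  by move=> A x; rewrite /power_sum big_seq1 !expr0.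
exists [seq (k + l)%N | k <- s, l <- t].
  move=> _ /allpairsP[[k l] /= [ks lt ->]].
  by rewrite mulSn leq_add ?tN //; exact: leq_bigmax_seq.
move=> A x; rewrite exprS ht /power_sum big_allpairs_dep /= mulr_suml.
apply: eq_bigr => k _; rewrite mulr_sumr; apply: eq_bigr => l _.
by rewrite exprD.
Qed.

Lemma regularP (R : realType) (S : comPzSemiRingType) (f : S -> R) :
  regular f <-> forall s x, f (power_sum s x) = power_sum s (f x).
Proof.
split=> h.
  by move=> s x; have [p hp] := poly_of_power_sum s; rewrite -!hp; exact: h.
by move=> x p; have [s hs] := power_sum_of_poly p; rewrite !hs.
Qed.

(** A term of the binomial convolution of two sequences; for sequences of powers it is the binomial
    expansion, and it still makes sense once powers are replaced by [b ^+ (j %/ e)]. *)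
Definition binom_sum (A : pzSemiRingType) (N : nat) (F G : nat -> A) : A :=
  \sum_(j < N.+1) F (N - j)%N * G j *+ 'C(N, j).

(** The loss is [q] for every complete block of length [e], plus a constant for the remainder. *)
Definition floor_dominated (T : comPzSemiRingType) (le : T -> T -> Prop)
    (e q : nat) (F G : nat -> T) : Prop :=
  exists K, forall j, le (F j) (2%:R ^+ (q * (j %/ e) + K) * G j).

Section FloorDomination.
Variables (T : comPzSemiRingType) (le : T -> T -> Prop).
Hypothesis sl : strassen_like le.
Let H := sl_psr sl.
Let h01 := sl_ge0 sl.

Lemma exp_divn_mod e j (x : T) : x ^+ j = (x ^+ e) ^+ (j %/ e) * x ^+ (j %% e).
Proof. by rewrite {1}(divn_eq j e) exprD mulnC exprM. Qed.

Lemma floor_exp_le e q x b : (0 < e)%N -> le (x ^+ e) (2%:R ^+ q * b) ->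
  floor_dominated le e q (GRing.exp x) (fun j => b ^+ (j %/ e)).
Proof.
move=> e0 xb; have [K hK] := sl_exp_dominates sl e x (sl_neq10 sl).
exists K => j /=; rewrite (exp_divn_mod e j x) -[b ^+ _]mulr1.
apply: (psr_pow2_mul H); first exact: psr_pow2_exp.
by have := hK _ (ltn_pmod j e0); rewrite expr1n.
Qed.

(** Here the right side has up to [e - 1] additional factors [x]; being nonzero, [x] has powers that
    dominate 1 up to a power of 2. *)
Lemma floor_exp_ge e q x b : (0 < e)%N -> x <> 0 -> le b (2%:R ^+ q * x ^+ e) ->
  floor_dominated le e q (fun j => b ^+ (j %/ e)) (GRing.exp x).
Proof.
move=> e0 x0 bx; have [K hK] := sl_exp_dominates sl e 1 x0.
exists K => j /=; rewrite (exp_divn_mod e j x) -[b ^+ _]mulr1.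
apply: (psr_pow2_mul H); first exact: psr_pow2_exp.
by have := hK _ (ltn_pmod j e0); rewrite expr1n.
Qed.

Lemma floor_dominated_sum e q F G : (0 < e)%N -> floor_dominated le e q F G ->
  exists K, forall M s, {in s, forall k, k <= M}%N ->
    le (\sum_(k <- s) F k) (2%:R ^+ (q * (M %/ e) + K) * \sum_(k <- s) G k).
Proof.
move=> e0 [K hK]; exists K => M s sM; rewrite mulr_sumr !big_seq.
apply: (psr_sum H) => k /sM kM; apply: (psr_pow2_leq H h01) (hK k).
by rewrite leq_add2r leq_mul2l leq_div2r ?orbT.
Qed.

Lemma floor_dominated_binom e q F G F' G' : (0 < e)%N ->
  floor_dominated le e q F G -> floor_dominated le e q F' G' ->
  exists K, forall N,
    le (binom_sum N F F') (2%:R ^+ (q * (N %/ e) + K) * binom_sum N G G').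
Proof.
move=> e0 [K hK] [L hL]; exists (K + L)%N => N; rewrite mulr_sumr.
apply: (psr_sum H) => j _; rewrite mulrnAr; apply: (psr_muln H).
apply: (psr_pow2_leq H h01) (psr_pow2_mul H (hK _) (hL _)).
(* The floors of [(N - j)/e] and [j/e] add up to at most that of [N/e], so the linear part of the
   error is not doubled. *)
rewrite addnACA leq_add2r -mulnDr leq_mul2l; apply/orP; right.
rewrite leq_divRL // mulnDl -[leqRHS](subnK (ltn_ord j : j <= N)%N).
by rewrite leq_add // leq_trunc_div.
Qed.

(** The ratio [q/e] can be made small against [1/(p c (D + 1))], which gives slope at most [1/p].
    Here [c] counts accumulated errors and [D] is a degree. *)
Lemma geo_le_error c D x y :
  (forall p, exists e q K, [/\ (0 < e)%N, (p * q <= e)%N &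
     forall N, le (x ^+ N) (2%:R ^+ (c * (q * (N * D %/ e) + K)) * y ^+ N)]) ->
  geo_le le x y.
Proof.
move=> h p p0; have [e [q [K [e0 pq hK]]]] := h (p * c * D.+1)%N.
exists (c * K)%N => N; apply: (psr_pow2_leq H h01) (hK N).
rewrite mulnDr leq_add2r leq_divRL // -(leq_pmul2r (ltn0Sn D)).
apply: (leq_trans (n := e * (N * D %/ e))%N).
  apply: leq_trans (leq_mul pq (leqnn _)); lia.
rewrite mulnC; apply: leq_trans (leq_trunc_div _ _) _.
by rewrite leq_mul2l leqnSn orbT.
Qed.

End FloorDomination.

Lemma binom_sumE (T : comPzSemiRingType) N (x y : T) :
  (x + y) ^+ N = binom_sum N (GRing.exp x) (GRing.exp y).
Proof. exact: exprDn. Qed.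

Lemma rmorph_binom_sum (S T : comPzSemiRingType) (i : {rmorphism S -> T})
    N F G :
  i (binom_sum N F G) = binom_sum N (i \o F) (i \o G).
Proof.
by rewrite rmorph_sum; apply: eq_bigr => j _; rewrite rmorphMn rmorphM.
Qed.

Lemma rmorph_power_sum (S T : comPzSemiRingType) (i : {rmorphism S -> T}) s x :
  i (power_sum s x) = power_sum s (i x).
Proof. by rewrite rmorph_sum; apply: eq_bigr => j _; rewrite rmorphXn. Qed.

(** Informally, [x] is the [e]-th root of [b] up to a factor [2^(q/e)]. *)
Definition pow_close (T : comPzSemiRingType) (le : T -> T -> Prop) (e q : nat)
    (x b : T) : Prop :=
  le (x ^+ e) (2%:R ^+ q * b) /\ le b (2%:R ^+ q * x ^+ e).

Section Close.
Variables (T : comPzSemiRingType) (le : T -> T -> Prop).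
Hypothesis sl : strassen_like le.
Let H := sl_psr sl.
Let h01 := sl_ge0 sl.

Lemma pow_close_leq e q q' x b :
  (q <= q')%N -> pow_close le e q x b -> pow_close le e q' x b.
Proof. by move=> qq' [h1 h2]; split; apply: (psr_pow2_leq H h01 qq'). Qed.

Lemma pow_close_refl x : pow_close le 1 0 x x.
Proof. by split; rewrite expr0 mul1r expr1; exact: psr_refl. Qed.

Lemma pow_close_exp n e q x b :
  pow_close le e q x b -> pow_close le (e * n) (q * n) x (b ^+ n).
Proof. by move=> [h1 h2]; split; rewrite (exprM x); exact: psr_pow2_exp. Qed.

Lemma pow_close_mul e q q' x y b b' :
  pow_close le e q x b -> pow_close le e q' y b' ->
  pow_close le e (q + q') (x * y) (b * b').
Proof.
by move=> [h1 h2] [h3 h4]; split; rewrite exprMn; exact: psr_pow2_mul.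
Qed.

Lemma pow_close_binom e q x y b b' : (0 < e)%N -> x <> 0 -> y <> 0 ->
  pow_close le e q x b -> pow_close le e q y b' ->
  exists K, forall N, pow_close le N (q * (N %/ e) + K) (x + y)
    (binom_sum N (fun j => b ^+ (j %/ e)) (fun j => b' ^+ (j %/ e))).
Proof.
move=> e0 x0 y0 [h1 h2] [h3 h4].
have [K hK] := floor_dominated_binom sl e0 (floor_exp_le sl e0 h1)
  (floor_exp_le sl e0 h3).
have [L hL] := floor_dominated_binom sl e0 (floor_exp_ge sl e0 x0 h2)
  (floor_exp_ge sl e0 y0 h4).
exists (K + L)%N => N; split; rewrite (binom_sumE N x y).
  by apply: (psr_pow2_leq H h01) (hK N); rewrite addnA leq_addr.
by apply: (psr_pow2_leq H h01) (hL N); rewrite leq_add2l leq_addl.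
Qed.

Lemma pow_close_power_sum e q x b :
  (0 < e)%N -> x <> 0 -> pow_close le e q x b ->
  exists K, forall M s, {in s, forall k, k <= M}%N ->
    pow_close le 1 (q * (M %/ e) + K) (power_sum s x)
      (power_sum [seq (k %/ e)%N | k <- s] b).
Proof.
move=> e0 x0 [h1 h2].
have [K hK] := floor_dominated_sum sl e0 (floor_exp_le sl e0 h1).
have [L hL] := floor_dominated_sum sl e0 (floor_exp_ge sl e0 x0 h2).
exists (K + L)%N => M s sM; rewrite /power_sum big_map; split; rewrite expr1.
  by apply: (psr_pow2_leq H h01) (hK M s sM); rewrite addnA leq_addr.
by apply: (psr_pow2_leq H h01) (hL M s sM); rewrite leq_add2l leq_addl.
Qed.

End Close.

Definition approximable (S T : comPzSemiRingType) (le : T -> T -> Prop)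
    (i : {rmorphism S -> T}) (x : T) : Prop :=
  forall p, exists e q b,
    [/\ (0 < e)%N, (p * q <= e)%N & pow_close le e q x (i b)].

(** * Closure properties of the approximable elements *)

Section Approximable.
Variables (S T : comPzSemiRingType) (le : T -> T -> Prop).
Variable i : {rmorphism S -> T}.
Hypothesis sl : strassen_like le.
Let H := sl_psr sl.
Let h01 := sl_ge0 sl.
Local Notation approx := (approximable le i).

Lemma approximable_image b : approx (i b).
Proof.
move=> p; exists 1%N, 0%N, b; rewrite muln0.
by split=> //; exact: pow_close_refl.
Qed.

(** The product of the two exponents serves as a common one; the errors add up, hence the precision
    [2p] for each element. *)
Lemma approximable2 x y : approx x -> approx y -> forall p,
  exists e q b b', [/\ (0 < e)%N, (p * q <= e)%N,
    pow_close le e q x (i b) & pow_close le e q y (i b')].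
Proof.
move=> hx hy p; have [e [q [b [e0 pq xb]]]] := hx p.*2.
have [e' [q' [b' [e'0 pq' yb']]]] := hy p.*2.
exists (e * e')%N, (q * e' + q' * e)%N, (b ^+ e'), (b' ^+ e); split.
- by rewrite muln_gt0 e0.
- by nia.
- apply: (pow_close_leq sl (leq_addr _ _)); rewrite rmorphXn.
  exact: pow_close_exp.
- apply: (pow_close_leq sl (leq_addl _ _)); rewrite rmorphXn mulnC.
  exact: pow_close_exp.
Qed.

(** The approximant is the expansion of [(x + y)^(e M)] with [x ^+ j] and [y ^+ j] replaced by
    powers of [b] and [b']. A large [M] makes the constant [K] negligible. *)
Lemma approximableD x y : approx x -> approx y -> approx (x + y).
Proof.
move=> hx hy; have [->|/eqP x0] := eqVneq x 0; first by rewrite add0r.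
have [->|/eqP y0] := eqVneq y 0; first by rewrite addr0.
move=> p; have [e [q [b [b' [e0 pq xb yb']]]]] := approximable2 hx hy p.*2.
have [K hK] := pow_close_binom sl e0 x0 y0 xb yb'.
pose M := (p.*2 * K).+1; exists (e * M)%N, (q * M + K)%N.
exists (binom_sum (e * M) (fun j => b ^+ (j %/ e)) (fun j => b' ^+ (j %/ e))).
split; [by rewrite muln_gt0 e0|by nia|].
have := hK (e * M)%N; rewrite mulKn // rmorph_binom_sum.
congr pow_close; apply: eq_bigr => j _ /=; by rewrite !rmorphXn.
Qed.

Lemma approximableM x y : approx x -> approx y -> approx (x * y).
Proof.
move=> hx hy p.
have [e [q [b [b' [e0 pq xb yb']]]]] := approximable2 hx hy p.*2.
exists e, (q + q)%N, (b * b'); split=> //; first by lia.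
by rewrite rmorphM; exact: pow_close_mul.
Qed.

Lemma approximable_root x :
  (forall p, exists e q y, [/\ (0 < e)%N, (p * q <= e)%N, pow_close le e q x y &
    approx y]) -> approx x.
Proof.
move=> h p; have [e [q [y [e0 pq [h1 h2] hy]]]] := h p.*2.
have [e' [q' [b [e'0 pq' [h3 h4]]]]] := hy p.*2.
exists (e * e')%N, (q * e' + q')%N, b; split.
- by rewrite muln_gt0 e0.
- by nia.
split; rewrite (exprM x).
  exact: (psr_pow2_trans H (psr_pow2_exp H _ h1) h3).
by rewrite addnC; exact: (psr_pow2_trans H h4 (psr_pow2_exp H _ h2)).
Qed.

End Approximable.

(** * Density of the image in the completion *)

Lemma completion_strassen_like (S : comPzSemiRingType) (le : S -> S -> Prop)
    (Sbar : comPzSemiRingType) (lebar : Sbar -> Sbar -> Prop)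
    (i : {rmorphism S -> Sbar}) :
  strassen_preorder le -> asymptotic_completion le 2%:R lebar i ->
  strassen_like lebar.
Proof.
move=> [H hn _] hi; have [Hbar anti] := completion_po hi.
have := completion_pu hi; rewrite rmorph_nat => pu.
have h01 : lebar 0 1.
  rewrite -(rmorph0 i) -(rmorph1 i); apply: (completion_mono hi).
  exact/(hn 0%N 1%N).
(* By antisymmetry [1 <= 0] would give [0 = 1], hence [2 = 0], but a power universal element is
   nonzero. *)
apply: power_universal_strassen_like => // h10; have [+ _ _] := pu; apply.
by rewrite mulr2n -(anti _ _ h01 h10) addr0.
Qed.

(* The hypothesis [sl] is a parameter of the type so that its semiring
   structure, which depends on it, can be inferred. *)
Record approx_sub (S T : comPzSemiRingType) (le : T -> T -> Prop)
    (i : {rmorphism S -> T}) (sl : strassen_like le) := ApproxSub {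
  approx_val : T;
  approx_valP : `[< approximable le i approx_val >] }.

Section ApproxSub.
Variables (S T : comPzSemiRingType) (le : T -> T -> Prop).
Variables (i : {rmorphism S -> T}) (sl : strassen_like le).
Local Notation U := (approx_sub i sl).

HB.instance Definition _ := [isSub for @approx_val S T le i sl].
HB.instance Definition _ := [Choice of approx_sub i sl by <:].

Lemma approximable_semiring_closed :
  semiring_closed (fun x : T => `[< approximable le i x >]).
Proof.
split; split=> [|x y /asboolP hx /asboolP hy]; apply/asboolP.
- by rewrite -(rmorph0 i); exact: approximable_image.
- exact: approximableD.
- by rewrite -(rmorph1 i); exact: approximable_image.
- exact: approximableM.
Qed.

HB.instance Definition _ := GRing.SubChoice_isSubComPzSemiRing.Build T
  (fun x : T => `[< approximable le i x >]) (approx_sub i sl)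
  approximable_semiring_closed.

HB.instance Definition _ := GRing.RMorphism.copy (@approx_val S T le i sl)
  (val : approx_sub i sl -> T).

Definition approx_le (x y : U) : Prop := le (approx_val x) (approx_val y).

Definition approx_in (b : S) : U :=
  ApproxSub sl (introT (asboolP _) (approximable_image i sl b)).

Fact approx_in_nmod : nmod_morphism approx_in.
Proof.
split=> [|x y]; apply: val_inj.
  by rewrite rmorph0 /= rmorph0.
by rewrite rmorphD /= rmorphD.
Qed.

Fact approx_in_monoid : monoid_morphism approx_in.
Proof.
split=> [|x y]; apply: val_inj.
  by rewrite rmorph1 /= rmorph1.
by rewrite rmorphM /= rmorphM.
Qed.

HB.instance Definition _ := GRing.isNmodMorphism.Build S U
  approx_in approx_in_nmod.
HB.instance Definition _ := GRing.isMonoidMorphism.Build S U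
  approx_in approx_in_monoid.

Lemma approx_val_pow2 k (x : U) :
  approx_val (2%:R ^+ k * x) = 2%:R ^+ k * approx_val x.
Proof. by rewrite rmorphM rmorphXn rmorph_nat. Qed.

Hypothesis po : partially_ordered_semiring le.

Lemma approx_sub_po : partially_ordered_semiring approx_le.
Proof.
have [H anti] := po; split; last by move=> x y xy yx; apply/val_inj/anti.
split=> [x|x y z|x y z xy|x y z xy]; rewrite /approx_le ?rmorphD ?rmorphM.
- exact: psr_refl.
- exact: psr_trans.
- exact: psr_add.
- exact: psr_mul.
Qed.

Lemma approx_sub_power_universal :
  power_universal le 2%:R -> power_universal approx_le 2%:R.
Proof.
move=> [two0 le12 pu]; split=> [two0'||x y x0 y0 xy].
- by apply: two0; rewrite -(rmorph_nat (@approx_val S T le i sl)) two0' rmorph0.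
- by rewrite /approx_le rmorph1 rmorph_nat.
- have n0 (z : U) : z <> 0 -> approx_val z <> 0.
    by move=> z0 e; apply: z0; apply: val_inj; rewrite rmorph0.
  have [k hk] := pu _ _ (n0 _ x0) (n0 _ y0) xy.
  by exists k; rewrite /approx_le approx_val_pow2.
Qed.

Lemma approx_asymp_le (a b : nat -> U) : asymp_le approx_le 2%:R a b <->
  asymp_le le 2%:R (fun n => approx_val (a n)) (fun n => approx_val (b n)).
Proof.
by split=> -[k hk le_k]; exists k => // n; have := le_k n;
  rewrite /approx_le approx_val_pow2.
Qed.

Lemma approx_geom (x : U) :
  (fun n => approx_val (geom x n)) = geom (approx_val x).
Proof. by apply/funext => n; rewrite /geom rmorphXn. Qed.

Lemma approx_sub_closed : asymp_closed le 2%:R -> asymp_closed approx_le 2%:R.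
Proof. by move=> cl x y /approx_asymp_le; rewrite !approx_geom => /cl. Qed.

(** The base [s] exists in the ambient semiring. It is approximable because [s ^+ n] is close to the
    approximable [a n], and closeness composes by [approximable_root]. *)
Lemma approx_sub_complete :
  asymp_complete le 2%:R -> asymp_complete approx_le 2%:R.
Proof.
move=> co a a0 ga.
have va0 n : approx_val (a n) <> 0.
  by move=> e; apply: (a0 n); apply: val_inj; rewrite rmorph0.
have {}ga : approx_geometric le 2%:R (fun n => approx_val (a n)).
  case: ga => [[/approx_asymp_le h1 /approx_asymp_le h2]|[_ [k hk ga]]].
    by left; rewrite approx_geom rmorph0 in h1 h2.
  right; split=> //; exists k => // t n t0; have := ga t n t0.
  by rewrite /approx_le !approx_val_pow2 rmorph_prod.
have [s [[k hk h1] [l hl h2]]] := co _ va0 ga.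
have sP : approximable le i s.
  apply: approximable_root => // p.
  have [N hN] := (sublinearP _).1 (sublinear_add hk hl) p.
  exists N.+1, (k N.+1 + l N.+1)%N, (approx_val (a N.+1)); split=> //.
  - by apply: hN.
  - split.
      exact: (psr_pow2_leq sl (sl_ge0 sl) (leq_addl _ _) (h2 _)).
    exact: (psr_pow2_leq sl (sl_ge0 sl) (leq_addr _ _) (h1 _)).
  - exact/asboolP/approx_valP.
exists (ApproxSub sl (introT (asboolP _) sP)).
by split; apply/approx_asymp_le; rewrite approx_geom; [exists k|exists l].
Qed.

End ApproxSub.

(* By uniqueness in the universal property, the inclusion of the subsemiring
   of approximable elements has a section, hence is onto. *)
Lemma completion_approximable (S : comPzSemiRingType) (le : S -> S -> Prop)
    (Sbar : comPzSemiRingType) (lebar : Sbar -> Sbar -> Prop)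
    (i : {rmorphism S -> Sbar}) :
  strassen_preorder le -> asymptotic_completion le 2%:R lebar i ->
  forall x, approximable lebar i x.
Proof.
move=> hS hi x; have sl := completion_strassen_like hS hi.
have [po mono pu cl co univ] := hi; rewrite rmorph_nat in pu cl co.
have [g [g_mono g_i _]] := univ _ _ _ (approx_sub_po i sl po)
  (approx_sub_power_universal i sl pu) (approx_sub_closed cl)
  (approx_sub_complete (sl := sl) co) (approx_in i sl) mono.
have [h [_ _ h_uniq]] := univ _ _ _ po pu cl co i mono.
have id_h := h_uniq idfun (fun _ _ => id) (fun _ => erefl).
have g_h := h_uniq (@approx_val S Sbar lebar i sl \o g) g_mono.
have <- : approx_val (g x) = x.
  by rewrite -[RHS]/(idfun x) id_h -g_h // => y /=; have /= <- := g_i y.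
exact/asboolP/approx_valP.
Qed.

(** * Extension of regular functionals *)

(** Scaling by powers of 2 is polynomial, so regular functionals commute with it. *)
Lemma power_sum_pow2 (A : comPzSemiRingType) q e (x : A) :
  power_sum (nseq (2 ^ q) e) x = 2%:R ^+ q * x ^+ e.
Proof.
by rewrite /power_sum big_nseq iter_addr_0 -(mulr_natl (x ^+ e)) natrX.
Qed.

Lemma power_sum_muln (A : pzSemiRingType) n (x : A) :
  power_sum (nseq n 1%N) x = x *+ n.
Proof. by rewrite /power_sum big_nseq iter_addr_0 expr1. Qed.

Lemma power_sum1 (A : pzSemiRingType) e (x : A) : power_sum [:: e] x = x ^+ e.
Proof. exact: big_seq1. Qed.

Lemma nnval_power_sum (R : realType) s (x : nnreal R) :
  nnval (power_sum s x) = power_sum s (nnval x).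
Proof. exact: (rmorph_power_sum (val : nnreal R -> R)). Qed.

Lemma pow_close_le (T : comPzSemiRingType) (le : T -> T -> Prop)
    e q q' x y b c :
  preordered_semiring le -> pow_close le e q x b -> pow_close le e q' y c ->
  le b c ->
  le (x ^+ e) (2%:R ^+ (q + q') * y ^+ e).
Proof.
move=> H [xb _] [_ cy] bc; apply: (psr_pow2_trans H xb).
exact: psr_trans bc cy.
Qed.

Lemma pow_close_exp_eq (T : comPzSemiRingType) (le : T -> T -> Prop)
    N q q' x y b :
  strassen_like le -> (q <= q')%N -> y ^+ N = x ->
  pow_close le 1 q x b -> pow_close le N q' y b.
Proof.
by move=> sl qq' yx /(pow_close_leq sl qq'); rewrite /pow_close expr1 yx.
Qed.

Section Extension.
Variables (R : realType) (S T : comPzSemiRingType) (le : T -> T -> Prop).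
Variables (i : {rmorphism S -> T}) (f : S -> nnreal R).
Hypothesis sl : strassen_like le.
Hypothesis dense : forall x, approximable le i x.
Hypothesis f_regular : forall s x, f (power_sum s x) = power_sum s (f x).
Hypothesis f_homo : forall x y, le (i x) (i y) -> nnle (f x) (f y).
Let H := sl_psr sl.
Let h01 := sl_ge0 sl.
Let slR := nnreal_strassen_like R.
Let HR := sl_psr slR.

Lemma regular_pow2 q e b : f (2%:R ^+ q * b ^+ e) = 2%:R ^+ q * f b ^+ e.
Proof. by rewrite -!power_sum_pow2. Qed.

Lemma regular_exp e b : f (b ^+ e) = f b ^+ e.
Proof. by rewrite -!power_sum1. Qed.

Lemma regular_mul_pow2 q b : f (2%:R ^+ q * b) = 2%:R ^+ q * f b.
Proof. by rewrite -[b in LHS]expr1 regular_pow2 expr1. Qed.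

Lemma regular0 : f 0 = 0.
Proof. by have := f_regular [::] 0; rewrite /power_sum !big_nil. Qed.

Lemma regular_muln n b : f (b *+ n) = f b *+ n.
Proof. by rewrite -!power_sum_muln. Qed.

Definition extends_at (x : T) (z : nnreal R) : Prop :=
  forall e b q,
    (le (i b) (2%:R ^+ q * x ^+ e) -> nnle (f b) (2%:R ^+ q * z ^+ e)) /\
    (le (x ^+ e) (2%:R ^+ q * i b) -> nnle (z ^+ e) (2%:R ^+ q * f b)).

(** The two halves of [extends_at] are the two families of [radical_cut]. They are compatible
    because bounds on [x] combine to a comparison between images of [i], which [f_homo] and
    regularity carry to [f]. *)
Lemma extends_at_ex x : exists z, extends_at x z.
Proof.
pose A r n := (0 < n)%N /\
  exists b q, le (i b) (2%:R ^+ q * x ^+ n) /\ r = nnval (f b) / 2 ^+ q.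
pose B r n := (0 < n)%N /\
  exists b q, le (x ^+ n) (2%:R ^+ q * i b) /\ r = 2 ^+ q * nnval (f b).
have [| | | |z [z0 hA hB]] := @radical_cut R A B.
- by move=> r n [n0 [b [q [_ ->]]]]; rewrite divr_ge0 ?exprn_ge0 ?nnval_ge0.
- by move=> r n [n0 [b [q [_ ->]]]]; rewrite mulr_ge0 ?exprn_ge0 ?nnval_ge0.
- have [k hk] := sl_dominates sl x (sl_neq10 sl).
  exists (2 ^+ k * nnval (f 1)), 1%N; split=> //; exists 1, k.
  by rewrite rmorph1 expr1.
- move=> r n t m [n0 [b [q [hb ->]]]] [m0 [c [l [hc ->]]]].
  have h1 := psr_pow2_exp H m hb; have h2 := psr_pow2_exp H n hc.
  rewrite exprAC in h1; have := psr_pow2_trans H h1 h2.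
  rewrite -(rmorph_nat i 2) -!(rmorphXn i) -(rmorphM i) => /f_homo.
  rewrite regular_exp regular_pow2 /nnle nnval_pow2 !nnvalX => h.
  rewrite expr_div_n exprMn -!exprM ler_pdivrMr ?exprn_gt0 //.
  by rewrite mulrC mulrA -exprD.
(* Radicals need a positive exponent; for [e = 0] the element [x] disappears and [f_homo]
   suffices. *)
exists (NNReal z0) => -[|e] b q; rewrite /nnle !nnval_pow2 nnvalX.
  rewrite !expr0; split=> h.
    have := f_homo (x := b) (y := 2%:R ^+ q * b ^+ 0).
    rewrite regular_pow2 rmorphM !rmorphXn rmorph_nat !expr0 => /(_ h).
    by rewrite /nnle nnval_pow2 nnval1.
  have := f_homo (x := b ^+ 0) (y := 2%:R ^+ q * b).
  rewrite regular_mul_pow2 regular_exp rmorphM !rmorphXn rmorph_nat !expr0.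
  by move=> /(_ h); rewrite /nnle nnval_pow2 nnval1.
split=> h.
  rewrite mulrC -ler_pdivrMr ?exprn_gt0 //; apply: hA.
  by split=> //; exists b, q.
by apply: hB; split=> //; exists b, q.
Qed.

Lemma extends_at_close e q x z b : extends_at x z ->
  pow_close le e q x (i b) -> pow_close (@nnle R) e q z (f b).
Proof. by move=> xz [h1 h2]; have [g1 g2] := xz e b q; split; auto. Qed.

(** An approximant [b] of [x] mediates: [z ^+ e] is close to [f b], and [i b] is bounded by [y ^+ e]
    up to [2^q]. *)
Lemma extends_at_homo x y z w :
  extends_at x z -> extends_at y w -> le x y -> nnle z w.
Proof.
move=> xz yw xy; apply/nnreal_geo_le/geo_le_root => // p.
have [e [q [b [e0 pq xb]]]] := dense x p.*2.
exists e, (q + q)%N; split=> //; first by lia.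
have [zb _] := extends_at_close xz xb; apply: (psr_pow2_trans HR zb).
apply: (yw e b q).1; apply: (psr_trans H xb.2).
by apply: (psr_mul H); exact: psr_exp.
Qed.

Lemma extends_at_unique x z w : extends_at x z -> extends_at x w -> z = w.
Proof.
move=> xz xw; have [_ anti] := nnreal_po R.
by apply: anti; [apply: (extends_at_homo xz xw)|apply: (extends_at_homo xw xz)];
  exact: psr_refl.
Qed.

(** The source of uniqueness: both sides of each bound in [extends_at] are power sums, so any
    regular monotone extension meets them. *)
Lemma extends_at_regular (F : T -> nnreal R) :
  (forall s x, F (power_sum s x) = power_sum s (F x)) ->
  (forall x y, le x y -> nnle (F x) (F y)) -> (forall b, F (i b) = f b) ->
  forall x, extends_at x (F x).
Proof.
move=> F_reg F_homo Fi x e b q; split=> /F_homo.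
  by rewrite Fi -!power_sum_pow2 F_reg.
by rewrite -power_sum1 F_reg power_sum1 -[i b]expr1 -power_sum_pow2 F_reg
  power_sum_pow2 expr1 Fi.
Qed.

Definition extension (x : T) : nnreal R := sval (cid (extends_at_ex x)).

Lemma extensionP x : extends_at x (extension x).
Proof. exact: (svalP (cid (extends_at_ex x))). Qed.

Lemma extension_homo x y : le x y -> nnle (extension x) (extension y).
Proof. by apply: extends_at_homo; exact: extensionP. Qed.

Lemma extension_image b : extension (i b) = f b.
Proof.
apply: (extends_at_unique (extensionP _)) => e c q.
rewrite -(rmorph_nat i 2) -!(rmorphXn i) -!(rmorphM i).
by split=> /f_homo; rewrite regular_mul_pow2 regular_exp.
Qed.

Lemma extension_close e q x b :
  pow_close le e q x (i b) -> pow_close (@nnle R) e q (extension x) (f b).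
Proof. exact: extends_at_close (extensionP x). Qed.

Lemma extension0 : extension 0 = 0.
Proof. by rewrite -[in LHS](rmorph0 i) extension_image regular0. Qed.

Lemma extension_neq0 x : x <> 0 -> extension x <> 0.
Proof.
move=> x0 z0; have [k hk] := sl_dominates sl 1 x0.
have := (extensionP x 1%N 1 k).1; rewrite rmorph1 expr1 => /(_ hk).
have f1 : f 1 = 1 by rewrite -[in LHS](expr0 0) regular_exp expr0.
by rewrite z0 f1 expr1 mulr0; exact: (sl_10 slR).
Qed.

(** The [N]-th powers of both sides are close to the same number, the value of [f] at the expansion
    with [x ^+ j] replaced by [b ^+ (j %/ e)]. *)
Lemma extension_power_sum s x :
  extension (power_sum s x) = power_sum s (extension x).
Proof.
have [->|/eqP x0] := eqVneq x 0.
  by rewrite -(rmorph0 i) -rmorph_power_sum !extension_image f_regular.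
have z0 := extension_neq0 x0; have [_ anti] := nnreal_po R.
suff h p : exists e q K, [/\ (0 < e)%N, (p * q <= e)%N & forall N,
    exists2 b, pow_close (@nnle R) N (q * (N * (\max_(k <- s) k) %/ e) + K)
                 (extension (power_sum s x)) b &
               pow_close (@nnle R) N (q * (N * (\max_(k <- s) k) %/ e) + K)
                 (power_sum s (extension x)) b].
  apply: anti; apply/nnreal_geo_le/(geo_le_error slR (c := 2)
    (D := \max_(k <- s) k)) => p; have [e [q [K [e0 pq hN]]]] := h p;
    exists e, q, K; split=> // N; have [b h1 h2] := hN N; rewrite mul2n -addnn.
    exact: (pow_close_le HR h1 h2 (psr_refl HR _)).
  exact: (pow_close_le HR h2 h1 (psr_refl HR _)).
have [e [q [b [e0 pq xb]]]] := dense x p.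
have [K hK] := pow_close_power_sum sl e0 x0 xb.
have [L hL] := pow_close_power_sum slR e0 z0 (extension_close xb).
exists e, q, (K + L)%N; split=> // N; have [t tN ht] := power_sum_exp s N.
exists (f (power_sum [seq (k %/ e)%N | k <- t] b)).
  apply: extension_close; rewrite rmorph_power_sum.
  apply: (pow_close_exp_eq sl _ (ht _ x) (hK _ t tN)).
  by rewrite addnA leq_addr.
rewrite f_regular; apply: (pow_close_exp_eq slR _ (ht _ _) (hL _ t tN)).
by rewrite leq_add2l leq_addl.
Qed.

(** This reduces inequalities between the extension of a sum and the sum of extensions to
    inequalities for [f] between two binomial sums. The factor [N * 1] matches [geo_le_error] with
    [D = 1]. *)
Lemma extension_binom x y : x <> 0 -> y <> 0 -> forall p,
  exists e q K b b', [/\ (0 < e)%N, (p * q <= e)%N & forall N,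
    pow_close (@nnle R) N (q * (N * 1 %/ e) + K) (extension (x + y))
      (f (binom_sum N (fun j => b ^+ (j %/ e)) (fun j => b' ^+ (j %/ e)))) /\
    pow_close (@nnle R) N (q * (N * 1 %/ e) + K) (extension x + extension y)
      (binom_sum N (fun j => f b ^+ (j %/ e)) (fun j => f b' ^+ (j %/ e)))].
Proof.
move=> x0 y0 p.
have [e [q [b [b' [e0 pq xb yb']]]]] := approximable2 sl (dense x) (dense y) p.
have [K hK] := pow_close_binom sl e0 x0 y0 xb yb'.
have [L hL] := pow_close_binom slR e0 (extension_neq0 x0) (extension_neq0 y0)
  (extension_close xb) (extension_close yb').
exists e, q, (K + L)%N, b, b'; split=> // N; rewrite muln1; split.
  apply: extension_close; rewrite rmorph_binom_sum.
  apply: (pow_close_leq sl) (_ : pow_close le N (q * (N %/ e) + K) _ _).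
    by rewrite addnA leq_addr.
  by have := hK N; congr pow_close; apply: eq_bigr => j _ /=; rewrite !rmorphXn.
by apply: (pow_close_leq slR) (hL N); rewrite leq_add2l leq_addl.
Qed.

Section Bounds.
Variable r : nnreal R -> nnreal R -> Prop.
Hypothesis Hr : preordered_semiring r.
Hypotheses (f_addr : forall x y, r (f x + f y) (f (x + y)))
           (f_mulr : forall x y, r (f x * f y) (f (x * y))).

(** The relation [r] is the order of the reals or its converse, so one induction serves lower and
    upper functionals. Powers and multiples are preserved exactly by regularity. *)
Lemma regular_binom_sum N e b b' :
  r (binom_sum N (fun j => f b ^+ (j %/ e)) (fun j => f b' ^+ (j %/ e)))
    (f (binom_sum N (fun j => b ^+ (j %/ e)) (fun j => b' ^+ (j %/ e)))).
Proof.
pose Q z w := r z (f w).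
apply: (big_ind2 Q) => [|z w z' w' h h'|j _]; rewrite /Q.
- by rewrite regular0; exact: psr_refl.
- exact: (psr_trans Hr (psr_add2 Hr h h') (f_addr _ _)).
- rewrite regular_muln; apply: (psr_muln Hr).
  by rewrite -!regular_exp.
Qed.

End Bounds.

Lemma extension_add_ge : (forall x y, nnle (f x + f y) (f (x + y))) ->
  (forall x y, nnle (f x * f y) (f (x * y))) ->
  forall x y, nnle (extension x + extension y) (extension (x + y)).
Proof.
move=> fD fM x y.
have [->|/eqP x0] := eqVneq x 0.
  by rewrite extension0 !add0r; exact: psr_refl.
have [->|/eqP y0] := eqVneq y 0.
  by rewrite extension0 !addr0; exact: psr_refl.
apply/nnreal_geo_le/(geo_le_error slR (c := 2) (D := 1)) => p.
have [e [q [K [b [b' [e0 pq hN]]]]]] := extension_binom x0 y0 p.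
exists e, q, K; split=> // N; have [h1 h2] := hN N; rewrite mul2n -addnn.
exact: (pow_close_le HR h2 h1 (regular_binom_sum HR fD fM _ _ _ _)).
Qed.

Let nnge (z w : nnreal R) := nnle w z.

Let nnge_psr : preordered_semiring nnge.
Proof.
split=> [z|z w t zw wt|z w t|z w t].
- exact: (psr_refl HR).
- exact: (psr_trans HR wt zw).
- exact: (psr_add HR).
- exact: (psr_mul HR).
Qed.

Lemma extension_add_le : (forall x y, nnle (f (x + y)) (f x + f y)) ->
  (forall x y, nnle (f (x * y)) (f x * f y)) ->
  forall x y, nnle (extension (x + y)) (extension x + extension y).
Proof.
move=> fD fM x y.
have [->|/eqP x0] := eqVneq x 0.
  by rewrite extension0 !add0r; exact: psr_refl.
have [->|/eqP y0] := eqVneq y 0.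
  by rewrite extension0 !addr0; exact: psr_refl.
apply/nnreal_geo_le/(geo_le_error slR (c := 2) (D := 1)) => p.
have [e [q [K [b [b' [e0 pq hN]]]]]] := extension_binom x0 y0 p.
exists e, q, K; split=> // N; have [h1 h2] := hN N; rewrite mul2n -addnn.
exact: (pow_close_le HR h1 h2 (regular_binom_sum nnge_psr fD fM _ _ _ _)).
Qed.

Lemma extension_mul_close x y p : exists e q b b',
  [/\ (0 < e)%N, (p * (q + q) <= e)%N,
    pow_close (@nnle R) e q (extension (x * y)) (f (b * b')) &
    pow_close (@nnle R) e q (extension x * extension y) (f b * f b')].
Proof.
(* The factor 4: a product doubles [q], and comparing two approximations doubles it again. *)
have [e [q [b [b' [e0 pq xb yb']]]]] :=
  approximable2 sl (dense x) (dense y) (4 * p)%N.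
exists e, (q + q)%N, b, b'; split=> //; first by lia.
  by apply: extension_close; rewrite rmorphM; exact: pow_close_mul.
by apply: pow_close_mul => //; exact: extension_close.
Qed.

Lemma extension_mul_ge : (forall x y, nnle (f x * f y) (f (x * y))) ->
  forall x y, nnle (extension x * extension y) (extension (x * y)).
Proof.
move=> fM x y; apply/nnreal_geo_le/geo_le_root => // p.
have [e [q [b [b' [e0 pq h1 h2]]]]] := extension_mul_close x y p.
by exists e, (q + q)%N; split=> //; exact: (pow_close_le HR h2 h1 (fM _ _)).
Qed.

Lemma extension_mul_le : (forall x y, nnle (f (x * y)) (f x * f y)) ->
  forall x y, nnle (extension (x * y)) (extension x * extension y).
Proof.
move=> fM x y; apply/nnreal_geo_le/geo_le_root => // p.
have [e [q [b [b' [e0 pq h1 h2]]]]] := extension_mul_close x y p.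
by exists e, (q + q)%N; split=> //; exact: (pow_close_le HR h1 h2 (fM _ _)).
Qed.

End Extension.

(** The common core of both parts: one extension, with the lower and the upper inequalities passed
    on by separate implications. *)
Lemma regular_extension (R : realType) (S : comPzSemiRingType)
    (le : S -> S -> Prop) (Sbar : comPzSemiRingType)
    (lebar : Sbar -> Sbar -> Prop) (i : {rmorphism S -> Sbar}) (f : S -> R) :
  strassen_preorder le -> asymptotic_completion le 2%:R lebar i ->
  (forall x, 0 <= f x) -> regular f -> (forall x y, le x y -> f x <= f y) ->
  exists F : Sbar -> R, [/\ [/\ forall x, 0 <= F x, regular F,
      forall x y, lebar x y -> F x <= F y & F \o i =1 f],
    (forall x y, f x + f y <= f (x + y)) ->
      (forall x y, f x * f y <= f (x * y)) ->
      (forall x y, F x + F y <= F (x + y)) /\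
      (forall x y, F x * F y <= F (x * y)),
    (forall x y, f (x + y) <= f x + f y) ->
      (forall x y, f (x * y) <= f x * f y) ->
      (forall x y, F (x + y) <= F x + F y) /\
      (forall x y, F (x * y) <= F x * F y) &
    forall F' : Sbar -> R, (forall x, 0 <= F' x) -> regular F' ->
      (forall x y, lebar x y -> F' x <= F' y) -> F' \o i =1 f -> F = F'].
Proof.
move=> hS hi f0 freg fhomo.
have sl := completion_strassen_like hS hi.
have dense := completion_approximable hS hi.
pose g x := NNReal (f0 x).
have lift_regular (A : comPzSemiRingType) (h : A -> R)
    (h0 : forall x, 0 <= h x) :
    regular h -> forall s x,
    NNReal (h0 (power_sum s x)) = power_sum s (NNReal (h0 x)).
  move=> /regularP h_reg s x; apply: nnval_inj.
  by rewrite nnval_power_sum /= h_reg.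
have g_reg s x : g (power_sum s x) = power_sum s (g x) by exact: lift_regular.
have g_homo x y : lebar (i x) (i y) -> nnle (g x) (g y).
  (* Applying [f] to the bounds [x^n <= 2^k y^n] and using regularity gives the same bounds between
     [f x] and [f y], where [geo_le] is the usual order. *)
  move=> /(completion_reflects R hS hi) xy; apply: nnreal_geo_le => p p0.
  have [K hK] := xy p p0; exists K => n; have := fhomo _ _ (hK n).
  by rewrite -(regular_exp g_reg) -(regular_pow2 g_reg).
pose F := extension sl g_reg g_homo.
have Fi b : F (i b) = g b by exact: extension_image.
exists (fun x => nnval (F x)); split.
- split=> [x||x y xy|b /=].
  + exact: nnval_ge0.
  + apply/regularP => s x; rewrite -nnval_power_sum; congr nnval.
    exact: extension_power_sum.
  + exact: extension_homo.
  + by rewrite Fi.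
- move=> fD fM.
  have gD x y : nnle (g x + g y) (g (x + y)) by rewrite /nnle nnvalD; exact: fD.
  have gM x y : nnle (g x * g y) (g (x * y)) by rewrite /nnle nnvalM; exact: fM.
  split=> x y.
    by rewrite -nnvalD; exact: extension_add_ge.
  by rewrite -nnvalM; exact: extension_mul_ge.
- move=> fD fM.
  have gD x y : nnle (g (x + y)) (g x + g y) by rewrite /nnle nnvalD; exact: fD.
  have gM x y : nnle (g (x * y)) (g x * g y) by rewrite /nnle nnvalM; exact: fM.
  split=> x y.
    by rewrite -nnvalD; exact: extension_add_le.
  by rewrite -nnvalM; exact: extension_mul_le.
move=> F' F'0 F'_reg F'_homo F'i; apply/funext => x.
pose G y := NNReal (F'0 y).
suff -> : F x = G x by [].
apply: (extends_at_unique sl dense (extensionP sl g_reg g_homo x)).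
apply: extends_at_regular => //; first exact: lift_regular.
by move=> b; apply: nnval_inj; exact: F'i.
Qed.

Theorem proposition4p6 (R : realType) (S : comPzSemiRingType)
    (le : S -> S -> Prop) (Sbar : comPzSemiRingType)
    (lebar : Sbar -> Sbar -> Prop) (i : {rmorphism S -> Sbar})
    (hS : strassen_preorder le)
    (hi : asymptotic_completion le 2%:R lebar i) :
  (forall f : S -> R, regular_lower_functional le f ->
     exists! fbar : Sbar -> R,
       regular_lower_functional lebar fbar /\ fbar \o i =1 f) /\
  (forall g : S -> R, regular_upper_functional le g ->
     exists! gbar : Sbar -> R,
       regular_upper_functional lebar gbar /\ gbar \o i =1 g).
Proof.
split=> f [[f0 fz f1 fD fM f_homo] f_reg];
  have [F [[F0 F_reg F_homo Fi] FL FU F_uniq]] :=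
    regular_extension hS hi f0 f_reg f_homo;
  exists F; (split; last by move=> F' [[[F'0 _ _ _ _ F'_homo] F'_reg] F'i];
    exact: F_uniq); split=> //; split=> //.
  have [FD FM] := FL fD fM.
  by split=> //; [rewrite -fz -(rmorph0 i)|rewrite -f1 -(rmorph1 i)]; exact: Fi.
have [FD FM] := FU fD fM.
by split=> //; [rewrite -fz -(rmorph0 i)|rewrite -f1 -(rmorph1 i)]; exact: Fi.
Qed.
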